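(* Let $\mathcal R$ be a unital ring, let $M$ be a right $\mathcal R$-module with $Th(M)=Th(M)^{\aleph_0}$ and let $n\ge1$. If $f:D\rightarrow D'$ is a definable bijection between definable sets $D,D'\subseteq M^n$, then $\Lambda_{\mathfrak A}(D)=\Lambda_{\mathfrak A}(D')$ for each colour $\mathfrak A\in\mathcal X^*$ of a nonempty pp-subset of $M^n$.
   Context: **pp-sets.** A right $\mathcal R$-module $M$ is viewed as a first order structure in the language $\langle 0,+,-,m_r: r\in\mathcal R\rangle$; ''definable'' means definable with parameters from $M$; a function is definable if its graph is. A pp-formula is a formula equivalent to one of the form $\exists y_1\dots\exists y_m\bigwedge_{i=1}^t\left(\sum_j x_jr_{ij}+\sum_k y_ks_{ik}+c_i=0\right)$ with $r_{ij},s_{ik}\in\mathcal R$ and parameters $c_i\in M$. A pp-set is a set defined by a pp-formula; it is empty or a coset of a subgroup defined by a parameter-free pp-formula (a pp-definable subgroup). $\mathcal L$ is the set of pp-subsets of $M^n$ ($n$ fixed), $\mathcal L^*=\mathcal L\setminus\{\emptyset\}$. **The condition $Th(M)=Th(M)^{\aleph_0}$** means $M\equiv M^{(\aleph_0)}$; equivalently, for every $m\ge1$ and all pp-definable subgroups $A,B$ of $M^m$, the index $[A:A\cap B]$ is $1$ or infinite. **Antichains, blocks.** $\mathcal A$ is the set of finite antichains (with respect to inclusion) in $\mathcal L^*$. For $\alpha,\beta\in\mathcal A$ write $\beta\prec\alpha$ if for each $B\in\beta$ there is $A\in\alpha$ with $B\subsetneq A$. A cell is a set $C=\bigcup\alpha\setminus\bigcup\beta$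 with $\beta\prec\alpha$ in $\mathcal A$; $\alpha=:P(C)$ and $\beta=:N(C)$ are uniquely determined by $C$. A block is a cell with $|P(C)|=1$. Every definable subset of $M^n$ is a finite disjoint union of blocks. **Local characteristics at $P\in\mathcal L^*$.** For $\alpha\in\mathcal A$, let $\mathcal K^P(\alpha)$ be the abstract simplicial complex whose faces are the nonempty sets $\gamma\subseteq\{A\in\alpha:A\supseteq P\}$ with $\bigcap\gamma\supsetneq P$ (equivalently, after quotienting each $A\supseteq P$ by the subgroup $P-p$, $p\in P$, the intersection of $\gamma$ is infinite). Let $\chi(\mathcal K)=\sum_{k\ge0}(-1)^kv_k$, $v_k$ the number of faces with $k+1$ elements, $\chi(\emptyset)=0$. Let $\delta(\alpha)(P)=1$ if $P\subseteq\bigcup\alpha$ and $0$ otherwise, and $\kappa_P(\alpha):=\chi(\mathcal K^P(\alpha))-\delta(\alpha)(P)$. For a cell $C$, $\kappa_P(C):=\kappa_P(P(C))-\kappa_P(N(C))$. For a definable $D\subseteq M^n$, $\kappa_P(D):=\sum_i\kappa_P(B_i)$ for any finite partition $D=\bigsqcup_iB_i$ into blocks (this is independent of the partition). For given $D$, $\kappa_P(D)\ne0$ for only finitely many $P\in\mathcal L^*$. **Coloured global characteristics.** The colour of $P\in\mathcal L^*$ is $[[P]]=\{A\in\mathcal L:$ there is a bijection $A\to P$ whose graph is a pp-set$\}$; $\mathcal X^*$ is the set of colours of elements of $\mathcal L^*$. For $\mathfrak A\in\mathcal X^*$ and definable $D\subseteq M^n$, $\Lambda_{\mathfrak A}(D):=-\sum_{P\in\mathfrak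 A}\kappa_P(D)$. *)

(* Defs.v *)
From HB Require Import structures.
From mathcomp Require Import all_boot all_order all_algebra finmap.
From mathcomp Require Import mathcomp_extra boolp classical_sets functions.
From mathcomp Require Import cardinality fsbigop.

Set Implicit Arguments.
Unset Strict Implicit.
Unset Printing Implicit Defensive.

Import Order.TTheory GRing.Theory Num.Theory.
Local Open Scope classical_set_scope.
Local Open Scope ring_scope.

(* A right R-module is a left module over the converse ring R^c; [rscale x r]
   is the right action of r on x. *)
Definition rscale (R : pzRingType) (M : lmodType R^c) (x : M) (r : R) : M :=
  (r : R^c) *: x.

(* Terms and formulas of the language <0, +, -, m_r : r in R>, whose free
   variables are indexed by 'I_n. The variable bound by [FEx] is the last of
   the n + 1 variables of its body. *)
Inductive term (R : pzRingType) (n : nat) : Type :=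
| TVar of 'I_n
| TZero
| TAdd of term R n & term R n
| TOpp of term R n
| TScale of term R n & R.

Inductive formula (R : pzRingType) : nat -> Type :=
| FEq n of term R n & term R n : formula R n
| FNot n of formula R n : formula R n
| FAnd n of formula R n & formula R n : formula R n
| FEx n of formula R (n + 1) : formula R n.

Fixpoint eval (R : pzRingType) (M : lmodType R^c) (n : nat) (x : 'rV[M]_n)
    (t : term R n) : M :=
  match t with
  | TVar i => x 0 i
  | TZero => 0
  | TAdd u v => eval x u + eval x v
  | TOpp u => - eval x u
  | TScale u r => rscale (eval x u) r
  end.

Fixpoint holds (R : pzRingType) (M : lmodType R^c) (n : nat)
    (phi : formula R n) : 'rV[M]_n -> Prop :=
  match phi in formula _ n return 'rV[M]_n -> Prop with
  | FEq _ t u => fun x => eval x t = eval x u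
  | FNot _ psi => fun x => ~ holds psi x
  | FAnd _ psi1 psi2 => fun x => holds psi1 x /\ holds psi2 x
  | FEx _ psi => fun x => exists a : M, holds psi (row_mx x (const_mx a))
  end.

Definition elem_equiv (R : pzRingType) (M N : lmodType R^c) : Prop :=
  forall phi : formula R 0,
    holds phi (0 : 'rV[M]_0) <-> holds phi (0 : 'rV[N]_0).

Section CountableDirectSum.
Variables (R : pzRingType) (M : lmodType R^c).

Definition fin_supp : {pred nat -> M} :=
  fun f => `[< finite_set [set i | f i != 0] >].

Fact fin_supp_submod_closed : submod_closed fin_supp.
Proof.
split=> [|r f g /asboolP finf /asboolP fing]; apply/asboolP.
  rewrite (_ : [set i | _] = set0) //.
  by apply/seteqP; split=> i //=; rewrite eqxx.
have sub : [set i | (r *: f + g) i != 0]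
    `<=` [set i | f i != 0] `|` [set i | g i != 0].
  move=> i /= nz; case: (eqVneq (f i) 0) => [fi0|]; last by left.
  by right; apply: contra nz => /eqP gi0; rewrite /= !fctE fi0 gi0 scaler0 addr0.
by apply: sub_finite_set sub _; rewrite finite_setU.
Qed.

HB.instance Definition _ :=
  GRing.isSubmodClosed.Build R^c (nat -> M) fin_supp fin_supp_submod_closed.

(* The direct sum M^(aleph_0), with componentwise operations. *)
Record direct_sum := DirectSum {
  direct_sum_val :> nat -> M;
  direct_sum_valP : direct_sum_val \in fin_supp
}.

HB.instance Definition _ := [isSub for direct_sum_val].
HB.instance Definition _ := [Choice of direct_sum by <:].
HB.instance Definition _ := [SubChoice_isSubLmodule of direct_sum by <:].

End CountableDirectSum.

(* Th(M) = Th(M)^{aleph_0} *)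
Definition theory_stable (R : pzRingType) (M : lmodType R^c) : Prop :=
  elem_equiv M (direct_sum M).

Section Definability.
Variables (R : pzRingType) (M : lmodType R^c).

Definition definable (n : nat) (D : set 'rV[M]_n) : Prop :=
  exists k (phi : formula R (n + k)) (c : 'rV[M]_k),
    D = [set x : 'rV[M]_n | holds phi (row_mx x c)].

Definition pp_set (n : nat) : set (set 'rV[M]_n) :=
  [set A | exists l t (r : 'M[R]_(t, n)) (s : 'M[R]_(t, l)) (c : 'rV[M]_t),
    A = [set x : 'rV[M]_n | exists y : 'rV[M]_l, forall i : 'I_t,
           \sum_j rscale (x 0 j) (r i j) + \sum_k rscale (y 0 k) (s i k)
             + c 0 i = 0]].

Definition graph_on (n m : nat) (D : set 'rV[M]_n)
    (f : 'rV[M]_n -> 'rV[M]_m) : set 'rV[M]_(n + m) :=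
  [set z | exists2 x, D x & z = row_mx x (f x)].

End Definability.

(* Euler characteristic of a finite simplicial complex, given by its finite set
   of nonempty faces; faces have at most as many elements as there are
   vertices, so larger k contribute nothing. *)
Definition simplicial_chi (T : choiceType) (K : {fset {fset T}}) : int :=
  \sum_(k < #|` (\bigcup_(g <- K) g)%fset |)
    (-1) ^+ k * (#|` [fset g in K | #|` g| == k.+1]%fset |)%:Z.

Section Characteristics.
Variables (R : pzRingType) (M : lmodType R^c) (n : nat).
Local Notation V := 'rV[M]_n.
Implicit Types (P A B C D : set V) (a b : {fset set V}).

Definition pp_set_ne : set (set V) := [set A | pp_set A /\ A !=set0].

Definition antichain a : Prop :=
  (forall A, A \in a -> pp_set_ne A) /\
  (forall A B, A \in a -> B \in a -> A `<=` B -> A = B).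

Definition prec b a : Prop :=
  forall B, B \in b -> exists2 A, A \in a & B `<` A.

Definition union_of a : set V := \bigcup_(A in [set` a]) A.

Definition represents (ab : {fset set V} * {fset set V}) C : Prop :=
  [/\ antichain ab.1, antichain ab.2, prec ab.2 ab.1
    & C = union_of ab.1 `\` union_of ab.2].

Definition cell C : Prop := exists ab, represents ab C.

(* The pair (P(C), N(C)) of a cell C. It is unique when
   Th(M) = Th(M)^{aleph_0}. *)
Definition cell_PN C : {fset set V} * {fset set V} :=
  xget (fset0, fset0) [set ab | represents ab C].
Definition cell_P C := (cell_PN C).1.
Definition cell_N C := (cell_PN C).2.

Definition block C : Prop := cell C /\ #|` cell_P C| = 1%N.

Definition face P a (g : {fset set V}) : Prop :=
  [/\ g != fset0, forall A, A \in g -> A \in a /\ P `<=` A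
    & P `<` \bigcap_(A in [set` g]) A].

Definition local_complex P a : {fset {fset set V}} :=
  [fset g in fpowerset a | `[< face P a g >]]%fset.

Definition delta a P : int := (`[< P `<=` union_of a >] : nat)%:Z.

Definition kappa_antichain P a : int :=
  simplicial_chi (local_complex P a) - delta a P.

Definition kappa_cell P C : int :=
  kappa_antichain P (cell_P C) - kappa_antichain P (cell_N C).

Definition block_partition (s : {fset set V}) D : Prop :=
  (forall B, B \in s -> block B) /\ partition [set` s] id D.

(* The value computed from some finite partition of D into blocks. When
   Th(M) = Th(M)^{aleph_0} and D is definable, such a partition exists and the
   value does not depend on it. *)
Definition kappa P D : int :=
  xget 0 [set k | exists2 s, block_partition s D
                           & k = \sum_(B <- s) kappa_cell P B].

Definition colour P : set (set V) :=
  [set A | pp_set A /\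
    exists2 f : V -> V, set_bij A P f & pp_set (graph_on A f)].

Definition colours : set (set (set V)) :=
  [set X | exists2 P, pp_set_ne P & X = colour P].

(* The sum has finite support when Th(M) = Th(M)^{aleph_0} and D is
   definable. *)
Definition Lambda (X : set (set V)) D : int := - \sum_(P \in X) kappa P D.

End Characteristics.

(* Main.v *)
(* Call a function a "combination" if it is a finite integer combination of
   indicators of nonempty pp-sets. When Th(M) = Th(M)^{aleph_0} the pp-sets are
   irreducible: one that is covered by finitely many others lies in one of
   them. This is a family of first-order sentences, which is clear in
   M^(aleph_0) by putting witnesses of noninclusion in different far
   coordinates. Hence the coefficients of a combination are unique, and
   inclusion-exclusion identifies - kappa_P(D) with the coefficient of 1_P in
   1_D; so Lambda_X(D) is the sum of the coefficients with colour X.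

   If G is the graph of a definable bijection D -> D' and A is the pp-set of a
   block A \ (B_1 u ... u B_k) in G, irreducibility shows that both projections
   are injective on A. So the combination for 1_G is carried by graphs of
   pp-bijections, the two projections carry it to combinations for 1_D and
   1_D', and corresponding terms have the same colour. *)
Require Import Defs.
From mathcomp Require Import all_boot all_order all_algebra finmap.
From mathcomp Require Import mathcomp_extra boolp classical_sets functions.
From mathcomp Require Import cardinality fsbigop.
From mathcomp Require Import zify.

Set Implicit Arguments.
Unset Strict Implicit.
Unset Printing Implicit Defensive.

Import Order.TTheory GRing.Theory Num.Theory.
Local Open Scope classical_set_scope.
Local Open Scope ring_scope.

(** * Transfer of first-order statements *)

Section Transfer.
Variable R : pzRingType.

(** A single formula serves all modules at once, which is what elementary equivalence can transport.
    The closure lemmas below build such formulas without writing them out. *)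
Definition uniformly_definable (m : nat)
    (U : forall N : lmodType R^c, 'rV[N]_m -> Prop) : Prop :=
  exists phi : formula R m, forall (N : lmodType R^c) x, U N x <-> holds phi x.

Lemma udef_ext m (U U' : forall N : lmodType R^c, 'rV[N]_m -> Prop) :
  (forall N x, U N x <-> U' N x) ->
  uniformly_definable U -> uniformly_definable U'.
Proof. by move=> e [phi h]; exists phi => N x; rewrite -e h. Qed.

Lemma udef_eq m (u v : term R m) :
  uniformly_definable (fun N x => eval x u = eval x v).
Proof. by exists (FEq u v). Qed.

Lemma udef_not m (U : forall N : lmodType R^c, 'rV[N]_m -> Prop) :
  uniformly_definable U -> uniformly_definable (fun N x => ~ U N x).
Proof. by move=> [phi h]; exists (FNot phi) => N x /=; rewrite h. Qed.

Lemma udef_and m (U U' : forall N : lmodType R^c, 'rV[N]_m -> Prop) :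
  uniformly_definable U -> uniformly_definable U' ->
  uniformly_definable (fun N x => U N x /\ U' N x).
Proof.
by move=> [phi h] [psi h']; exists (FAnd phi psi) => N x /=; rewrite h h'.
Qed.

Lemma udef_imply m (U U' : forall N : lmodType R^c, 'rV[N]_m -> Prop) :
  uniformly_definable U -> uniformly_definable U' ->
  uniformly_definable (fun N x => U N x -> U' N x).
Proof.
move=> h h'; apply: udef_ext (udef_not (udef_and h (udef_not h'))) => N x.
split=> [nh u|hi [u]]; last by apply; exact: hi.
by apply: contrapT => nu'; exact: nh.
Qed.

Lemma udef_forall_fin m (I : finType)
    (U : I -> forall N : lmodType R^c, 'rV[N]_m -> Prop) :
  (forall i, uniformly_definable (U i)) ->
  uniformly_definable (fun N x => forall i, U i N x).
Proof.
move=> hU.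
suff: forall s : seq I,
    uniformly_definable (fun N x => forall i, i \in s -> U i N x).
  move=> /(_ (enum I)); apply: udef_ext => N x.
  by split=> h i //; apply: h; rewrite mem_enum.
elim=> [|a s IHs].
  by apply: udef_ext (udef_eq (TZero R m) (TZero R m)) => N x; split.
apply: udef_ext (udef_and (hU a) IHs) => N x; split.
  by move=> [ha hs] i; rewrite inE => /orP[/eqP->|/hs].
by move=> h; split=> [|i si]; apply: h; rewrite inE ?eqxx ?si ?orbT.
Qed.

Lemma udef_exists_fin m (I : finType)
    (U : I -> forall N : lmodType R^c, 'rV[N]_m -> Prop) :
  (forall i, uniformly_definable (U i)) ->
  uniformly_definable (fun N x => exists i, U i N x).
Proof.
move=> hU.
apply: udef_ext (udef_not (udef_forall_fin (fun i => udef_not (hU i)))).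
move=> N x; split=> [nh|[i Ui] /(_ i)//].
by apply: contrapT => ne; apply: nh => i Ui; apply: ne; exists i.
Qed.

(** [FEx] binds one variable, so the block of [l] variables is peeled off by induction on [l]. The
    casts only reconcile index types such as those of [m + l.+1] and [m + l + 1]. *)
Lemma udef_exists m l (U : forall N : lmodType R^c, 'rV[N]_(m + l) -> Prop) :
  uniformly_definable U ->
  uniformly_definable (fun N x => exists y : 'rV[N]_l, U N (row_mx x y)).
Proof.
elim: l U => [|l IHl] U [phi hphi].
  exists (ecast k (formula R k) (addn0 m) phi) => N x.
  transitivity (holds phi (row_mx x (0 : 'rV_0))).
    split=> [[y]|h]; first by rewrite (thinmx0 y) hphi.
    by exists 0; rewrite hphi.
  suff cast k (e : (m + 0)%N = k) (z : 'rV[N]_(m + 0)) :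
      holds phi z <-> holds (ecast k (formula R k) e phi) (castmx (erefl _, e) z).
    rewrite (cast _ (addn0 m)).
    rewrite (_ : castmx _ _ = x) //; apply/rowP => i.
    rewrite castmxE /= /row_mx !mxE; case: splitP => j; last by case: j.
    move=> /= ej; congr (x _ _); [exact: ord1|exact: val_inj].
  by case: k / e; rewrite castmx_id.
have e : (m + l.+1 = m + l + 1)%N by rewrite addn1 addnS.
pose psi := FEx (ecast k (formula R k) e phi).
have [theta htheta] := IHl (fun N x => holds psi x)
  (ex_intro _ psi (fun _ _ => iff_refl _)).
exists theta => N x; rewrite -htheta /psi /=.
have cast k (e' : (m + l.+1)%N = k) (z : 'rV[N]_(m + l.+1)) :
    holds phi z <-> holds (ecast k (formula R k) e' phi) (castmx (erefl _, e') z).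
  by case: k / e'; rewrite castmx_id.
(* Entries are compared through the numerical value of their index, since [y] and [y'] are indexed
   by the different types ['I_(l + 1)] and ['I_l.+1]. *)
have key (y : 'rV[N]_(l + 1)) (y' : 'rV[N]_(l.+1)) :
    (forall (i : 'I_(l + 1)) (j : 'I_l.+1), i = j :> nat -> y 0 i = y' 0 j) ->
    row_mx (row_mx x (lsubmx y)) (rsubmx y)
      = castmx (erefl _, e) (row_mx x y').
  move=> hy; apply/rowP => i; rewrite castmxE !mxE /= cast_ord_id.
  case: splitP => j ej; rewrite ?mxE; last first.
    case: splitP => /= j' ej'; rewrite ?mxE.
      by move: (ltn_ord j'); rewrite -ej' ej ltnNge -addnA leq_addr.
    apply: hy => /=.
    by apply/eqP; rewrite -(eqn_add2l m) -ej' ej addnA.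
  case: splitP => j' ej'; case: splitP => /= j2 ej2; rewrite ?mxE.
  - by congr (x _ _); apply: val_inj; rewrite /= -ej2 ej.
  - by move: (ltn_ord j'); rewrite -ej' -ej ej2 ltnNge leq_addr.
  - by move: (ltn_ord j2); rewrite -ej2 ej ej' ltnNge leq_addr.
  apply: hy => /=; apply/eqP; rewrite -(eqn_add2l m) -ej'.
  by rewrite -ej -ej2.
split=> [[y' /hphi Uy]|[y [a h]]].
  pose y : 'rV[N]_(l + 1) := castmx (erefl _, esym (addn1 l)) y'.
  exists (lsubmx y), (y 0 (rshift l ord0)).
  rewrite (_ : const_mx _ = rsubmx y); last first.
    by apply/rowP => i; rewrite (ord1 i) 2!mxE.
  rewrite (key y y') -?cast // => i j eij.
  by rewrite castmxE cast_ord_id; congr (y' _ _); apply: val_inj.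
pose y0 := row_mx y (const_mx a) : 'rV[N]_(l + 1).
pose y' : 'rV[N]_(l.+1) := castmx (erefl _, addn1 l) y0.
exists y'; apply/hphi; rewrite (cast _ e).
rewrite -(key y0 y') ?row_mxKl ?row_mxKr// => i j eij.
by rewrite castmxE cast_ord_id; congr (y0 _ _); apply: val_inj.
Qed.

Lemma udef_forall m l (U : forall N : lmodType R^c, 'rV[N]_(m + l) -> Prop) :
  uniformly_definable U ->
  uniformly_definable (fun N x => forall y : 'rV[N]_l, U N (row_mx x y)).
Proof.
move=> hU; apply: udef_ext (udef_not (udef_exists (udef_not hU))) => N x.
split=> [h y|h [y]]; last exact.
by apply: contrapT => nU; apply: h; exists y.
Qed.

Lemma elem_equiv_udef (M N : lmodType R^c)
    (U : forall N : lmodType R^c, 'rV[N]_0 -> Prop) :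
  elem_equiv M N -> uniformly_definable U -> U M 0 <-> U N 0.
Proof. by move=> e [phi h]; rewrite !h. Qed.

Definition tsum m (s : seq (term R m)) : term R m :=
  foldr (@TAdd R m) (TZero R m) s.

Lemma eval_tsum (N : lmodType R^c) m (x : 'rV[N]_m) (I : finType)
    (t : I -> term R m) :
  eval x (tsum [seq t i | i <- index_enum I]) = \sum_i eval x (t i).
Proof.
by elim: (index_enum I) => [|i s IHs]; rewrite ?big_nil// big_cons -IHs.
Qed.

Fixpoint term_lshift m l (t : term R m) : term R (m + l) :=
  match t with
  | TVar i => TVar R (lshift l i)
  | TZero => TZero R (m + l)
  | TAdd u v => TAdd (term_lshift l u) (term_lshift l v)
  | TOpp u => TOpp (term_lshift l u)
  | TScale u r => TScale (term_lshift l u) r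
  end.

Lemma eval_lshift (N : lmodType R^c) m l (x : 'rV[N]_m) (y : 'rV[N]_l)
    (t : term R m) :
  eval (row_mx x y) (term_lshift l t) = eval x t.
Proof.
by elim: t => //= [i|u -> v ->|u ->|u -> r] //; rewrite row_mxEl.
Qed.

End Transfer.

(** * Subgroups defined by parameter-free pp-formulas, uniformly in the module *)

Record pp_system (R : pzRingType) (n : nat) := PPSystem {
  pp_unknowns : nat;
  pp_eqns : nat;
  pp_coefs : 'M[R]_(pp_eqns, n);
  pp_ucoefs : 'M[R]_(pp_eqns, pp_unknowns) }.

Definition pp_group (R : pzRingType) (n : nat) (d : pp_system R n)
    (N : lmodType R^c) (x : 'rV[N]_n) : Prop :=
  exists y : 'rV[N]_(pp_unknowns d), forall i,
    \sum_j rscale (x 0 j) (pp_coefs d i j)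
    + \sum_k rscale (y 0 k) (pp_ucoefs d i k) = 0.

Section PPGroup.
Variables (R : pzRingType) (n : nat) (d : pp_system R n).

(** A homomorphism carries a witness [y] to a witness for the image. The maps used later are the
    coordinate injections and projections of the direct sum. *)
Lemma pp_group_hom (N N' : lmodType R^c) (g : N -> N')
    (gD : {morph g : x y / x + y}) (gZ : forall (r : R^c), {morph g : x / r *: x})
    (x : 'rV[N]_n) :
  pp_group d x -> pp_group d (map_mx g x).
Proof.
have g0 : g 0 = 0 by apply: (@addrI _ (g 0)); rewrite -gD !addr0.
move=> [y hy]; exists (map_mx g y) => i.
rewrite -[RHS]g0 -[in RHS](hy i) gD !(big_morph g gD g0).
by congr (_ + _); apply: eq_bigr => j _; rewrite mxE gZ.
Qed.

Variable N : lmodType R^c.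

Lemma pp_group0 : pp_group d (0 : 'rV[N]_n).
Proof.
exists 0 => i; rewrite !big1 ?addr0// => j _; rewrite mxE; exact: scaler0.
Qed.

Lemma pp_groupD (x y : 'rV[N]_n) :
  pp_group d x -> pp_group d y -> pp_group d (x + y).
Proof.
move=> [u hu] [v hv]; exists (u + v) => i.
have := congr2 +%R (hu i) (hv i); rewrite addr0 addrACA -!big_split => h.
rewrite -[RHS]h; congr (_ + _); apply: eq_bigr => j _; rewrite mxE; exact: scalerDr.
Qed.

Lemma pp_group_sum (I : Type) (s : seq I) (F : I -> 'rV[N]_n) :
  (forall i, pp_group d (F i)) -> pp_group d (\sum_(i <- s) F i).
Proof.
by move=> hF; elim/big_ind: _ => //; [exact: pp_group0 | exact: pp_groupD].
Qed.

End PPGroup.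

Section CosetTransfer.
Variables (R : pzRingType) (n k : nat).
Variables (d : pp_system R n) (e : 'I_k -> pp_system R n).

Lemma udef_pp_group m (e0 : pp_system R n) (u : 'I_n -> term R m) :
  uniformly_definable (fun (N : lmodType R^c) (z : 'rV[N]_m) =>
    pp_group e0 (\row_j eval z (u j))).
Proof.
pose l := pp_unknowns e0.
pose tx (i : 'I_(pp_eqns e0)) (j : 'I_n) : term R (m + l) :=
  TScale (term_lshift l (u j)) (pp_coefs e0 i j).
pose ty (i : 'I_(pp_eqns e0)) (j : 'I_l) : term R (m + l) :=
  TScale (TVar R (rshift m j)) (pp_ucoefs e0 i j).
pose t i := TAdd (tsum [seq tx i j | j <- index_enum _])
                 (tsum [seq ty i j | j <- index_enum _]).
have h := udef_exists (udef_forall_fin (fun i => udef_eq (t i) (TZero R _))).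
apply: udef_ext h => N z.
have teq (y : 'rV[N]_l) i : eval (row_mx z y) (t i) =
    \sum_j rscale ((\row_j eval z (u j)) 0 j) (pp_coefs e0 i j)
    + \sum_k rscale (y 0 k) (pp_ucoefs e0 i k).
  rewrite /= !eval_tsum; congr (_ + _); apply: eq_bigr => j _ /=.
    by rewrite eval_lshift mxE.
  by rewrite row_mxEr.
by split=> [[y hy]|[y hy]]; exists y => i; [rewrite -teq|rewrite teq]; exact: hy.
Qed.

(** All [k] coset shifts are packed into one row [b] of length [k * n], so that the statement is a
    first-order sentence with a single outer block of existential variables. *)
Definition covered (N : lmodType R^c) : Prop :=
  exists b : 'rV[N]_(k * n), forall x : 'rV[N]_n,
    pp_group d x ->
    exists i : 'I_k, pp_group (e i) (x - \row_j b 0 (mxvec_index i j)).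

Lemma covered_equiv (M N : lmodType R^c) :
  elem_equiv M N -> covered M -> covered N.
Proof.
move=> MN.
pose U (N : lmodType R^c) (z : 'rV[N]_(0 + k * n + n)) :=
  pp_group d (\row_j z 0 (rshift (0 + k * n) j)) ->
  exists i : 'I_k, pp_group (e i) (\row_j z 0 (rshift (0 + k * n) j) -
    \row_j z 0 (lshift n (rshift 0 (mxvec_index i j)))).
have hU : uniformly_definable U.
  pose tx j : term R (0 + k * n + n) := TVar R (rshift (0 + k * n) j).
  pose tb i j : term R (0 + k * n + n) :=
    TVar R (lshift n (rshift 0 (mxvec_index i j))).
  have h := udef_imply (udef_pp_group d tx)
    (udef_exists_fin (fun i : 'I_k =>
       udef_pp_group (e i) (fun j => TAdd (tx j) (TOpp (tb i j))))).
  apply: udef_ext h => L z.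
  suff eqr i : \row_j eval z (TAdd (tx j) (TOpp (tb i j))) =
     \row_j z 0 (rshift (0 + k * n) j) -
     \row_j z 0 (lshift n (rshift 0 (mxvec_index i j))).
    by split=> h1 /h1 [i hi]; exists i; move: hi; rewrite eqr.
  by apply/rowP => j; rewrite !mxE.
have hC := udef_exists (udef_forall hU).
have covE (L : lmodType R^c) : covered L <->
    exists b : 'rV[L]_(k * n), forall x : 'rV[L]_n,
      U L (row_mx (row_mx (0 : 'rV_0) b) x).
  have eqx (b : 'rV[L]_(k * n)) (x : 'rV[L]_n) :
      \row_j row_mx (row_mx (0 : 'rV_0) b) x 0 (rshift (0 + k * n) j) = x.
    by apply/rowP => j; rewrite mxE row_mxEr.
  have eqb (b : 'rV[L]_(k * n)) (x : 'rV[L]_n) i :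
      \row_j row_mx (row_mx (0 : 'rV_0) b) x 0
         (lshift n (rshift 0 (mxvec_index i j)))
      = \row_j b 0 (mxvec_index i j).
    by apply/rowP => j; rewrite [LHS]mxE (row_mxEl (row_mx _ _)) row_mxEr [RHS]mxE.
  split=> [[b hb]|[b hb]]; exists b => x hx.
    have [i hi] : exists i : 'I_k, pp_group (e i) (x - \row_j b 0 (mxvec_index i j)).
      by apply: hb; rewrite eqx in hx.
    by exists i; rewrite eqx eqb.
  have [|i] := hb x; first by rewrite eqx.
  by rewrite eqx eqb => hi; exists i.
by rewrite !covE; exact: (elem_equiv_udef MN hC).1.
Qed.

End CosetTransfer.

(** * Irreducibility of pp-sets *)

Section DirectSum.
Variables (R : pzRingType) (M : lmodType R^c).
Notation N := (direct_sum M).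

Definition dsproj (m : nat) (f : N) : M := f m.

Lemma dsprojD m : {morph dsproj m : f g / f + g}.
Proof. by []. Qed.

Lemma dsprojZ m (r : R^c) : {morph dsproj m : f / r *: f}.
Proof. by []. Qed.

Fact dsinj_subproof (m : nat) (a : M) :
  (fun i => if i == m then a else 0) \in fin_supp (M := M).
Proof.
apply/asboolP; apply: sub_finite_set (finite_set1 m) => i /=.
by case: (eqVneq i m) => // _; rewrite eqxx.
Qed.

Definition dsinj m (a : M) : N := DirectSum (dsinj_subproof m a).

Lemma dsinjD m : {morph dsinj m : a b / a + b}.
Proof.
move=> a b; apply/val_inj/funext => i.
transitivity (dsinj m a i + dsinj m b i); last by [].
rewrite /=; by case: eqP; rewrite ?addr0.
Qed.

Lemma dsinjZ m (r : R^c) : {morph dsinj m : a / r *: a}.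
Proof.
move=> a; apply/val_inj/funext => i.
transitivity (r *: dsinj m a i); last by [].
rewrite /=; by case: eqP; rewrite ?scaler0.
Qed.

Lemma direct_sum_bound (f : N) : exists K, forall m, (K <= m)%N -> f m = 0.
Proof.
have /asboolP/finite_fsetP[X hX] := direct_sum_valP f.
exists (\max_(i <- X) i).+1 => m hm; apply: contrapT => /eqP nz.
have mX : m \in X by have : [set` X] m by rewrite -hX.
by have := @leq_bigmax_seq _ _ xpredT id m mX isT; rewrite leqNgt hm.
Qed.

Lemma direct_sum_bound_fin (I : finType) (F : I -> N) :
  exists K, forall i m, (K <= m)%N -> F i m = 0.
Proof.
have [K hK] := choice (fun i => direct_sum_bound (F i)).
exists (\max_i K i) => i m hm; apply: hK.
exact: leq_trans (leq_bigmax i) hm.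
Qed.

(* For [h i] in the group of [d] but not in that of [e i], the sum of the
   [h i], each placed in its own coordinate beyond the supports of the shifts
   [b], avoids every coset. *)
Lemma direct_sum_not_covered n k (d : pp_system R n)
    (e : 'I_k -> pp_system R n) :
  (forall i, exists2 h : 'rV[M]_n, pp_group d h & ~ pp_group (e i) h) ->
  ~ covered d e N.
Proof.
move=> /(_ _)/cid2-/all_sig2[h hd he] [b hb].
have [K hK] := direct_sum_bound_fin (fun j => b 0 j).
pose x := \sum_(i < k) map_mx (dsinj (K + i)) (h i).
have hx : pp_group d x.
  apply: pp_group_sum => i; apply: pp_group_hom (hd i).
    exact: dsinjD.
  exact: dsinjZ.
have [i hi] := hb x hx; apply: (he i).
have := pp_group_hom (dsprojD (K + i)) (dsprojZ (K + i)) hi.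
congr pp_group; apply/rowP => j.
have proj0 : dsproj (K + i) 0 = 0 by [].
rewrite mxE [X in dsproj _ X]mxE dsprojD summxE.
rewrite (big_morph _ (dsprojD (K + i)) proj0).
rewrite (bigD1 i) //= big1 ?addr0 => [|i' ne]; last first.
  by rewrite mxE /dsproj /= eqn_add2l eq_sym val_eqE (negPf ne).
rewrite mxE {1}/dsproj /= eqxx !mxE.
rewrite (_ : dsproj _ (- _) = - b 0 (mxvec_index i j) (K + i)%N) //.
by rewrite hK ?leq_addr// subr0.
Qed.

End DirectSum.

Section Irreducible.
Variables (R : pzRingType) (M : lmodType R^c) (n : nat).
Implicit Types A B : set 'rV[M]_n.

(** Subtracting two solutions removes the parameters [c], so [d] is the homogeneous part of the
    system. *)
Lemma pp_set_coset A : pp_set A ->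
  exists d : pp_system R n, forall a z, A a -> A z <-> pp_group d (z - a).
Proof.
move=> [l [t [r [s [c ->]]]]]; exists (PPSystem r s) => a z [u hu].
have E (y : 'rV[M]_l) i :
    (\sum_j rscale ((z - a) 0 j) (r i j)
     + \sum_k rscale ((y - u) 0 k) (s i k)) =
    (\sum_j rscale (z 0 j) (r i j) + \sum_k rscale (y 0 k) (s i k) + c 0 i)
    - (\sum_j rscale (a 0 j) (r i j) + \sum_k rscale (u 0 k) (s i k) + c 0 i).
  rewrite opprD addrACA subrr addr0 opprD addrACA -!sumrB.
  by congr (_ + _); apply: eq_bigr => j _; rewrite !mxE; exact: scalerBr.
split=> [[y hy]|[y hy]].
  by exists (y - u) => i; rewrite /= E hy hu subr0.
exists (y + u) => i; have := E (y + u) i; rewrite addrK hu subr0 => <-.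
exact: hy.
Qed.

(** After translation by [a], the inclusion becomes a coset covering of the subgroup of [A], and
    [covered] passes to the direct sum. There it fails as soon as no single subgroup contains that
    of [A], which is what [A] lying in no [B i] gives. *)
Lemma pp_set_irreducible A (I : finType) (B : I -> set 'rV[M]_n) :
  theory_stable M -> pp_set A -> A !=set0 -> (forall i, pp_set (B i)) ->
  A `<=` \bigcup_i B i -> exists i, A `<=` B i.
Proof.
move=> hM ppA [a Aa] ppB AB; apply: contrapT => nAB.
have {}nAB i : ~ A `<=` B i by move=> Ai; apply: nAB; exists i.
(* Only the [B i] that meet [A] matter; for those, a common point presents [A] and [B i] as cosets
   with the same shift. *)
pose J : {set I} := [set i | `[< A `&` B i !=set0 >]]%SET.
have hJ (i : 'I_#|J|) : exists z, A z /\ B (enum_val i) z.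
  by have := enum_valP i; rewrite inE => /asboolP[z]; exists z.
have {hJ}[b hb] := choice hJ.
have [d hd] := pp_set_coset ppA.
have [e he] := choice (fun i : 'I_#|J| => pp_set_coset (ppB (enum_val i))).
apply: (@direct_sum_not_covered R M n _ d e).
  move=> i; apply: contrapT => ne; apply: (nAB (enum_val i)) => z Az.
  have [Abi Bbi] := hb i.
  apply/(he i (b i)) => //; apply: contrapT => nz; apply: ne.
  by exists (z - b i) => //; exact/hd.
apply: covered_equiv hM _.
exists (mxvec (\matrix_(i, j) (b i - a) 0 j)) => x dx.
have Aax : A (a + x) by apply/(hd a) => //; rewrite addrC addKr.
have [i _ Bi] := AB _ Aax.
have iJ : i \in J by rewrite inE; apply/asboolP; exists (a + x).
exists (enum_rank_in iJ i).
rewrite (_ : \row_j _ = b (enum_rank_in iJ i) - a); last first.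
  by apply/rowP => j; rewrite mxE mxvecE mxE.
rewrite opprB addrA (addrC x); apply/he; first exact: (hb _).2.
by rewrite enum_rankK_in.
Qed.

End Irreducible.

(** * Closure properties of pp-sets *)

Section Affine.
Variables (R : pzRingType) (M : lmodType R^c).

Definition affine m (g : 'rV[M]_m -> M) : Prop :=
  exists (r : 'I_m -> R) (c : M),
    forall x, g x = \sum_j rscale (x 0 j) (r j) + c.

Definition affine_map m n (h : 'rV[M]_m -> 'rV[M]_n) : Prop :=
  forall j, affine (fun x => h x 0 j).

Lemma affine_ext m (g g' : 'rV[M]_m -> M) :
  g =1 g' -> affine g -> affine g'.
Proof. by move=> e [r [c h]]; exists r, c => x; rewrite -e. Qed.

Lemma affine_cst m (a : M) : affine (fun _ : 'rV[M]_m => a).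
Proof.
exists (fun=> 0), a => x; rewrite big1 ?add0r// => j _; exact: scale0r.
Qed.

Lemma affine_coord m (i : 'I_m) : affine (fun x : 'rV[M]_m => x 0 i).
Proof.
exists (fun j => (j == i)%:R), 0 => x; rewrite addr0 (bigD1 i) //= eqxx.
rewrite big1 ?addr0 => [|j /negPf->]; last exact: scale0r.
by symmetry; exact: scale1r.
Qed.

Lemma affineD m (g h : 'rV[M]_m -> M) :
  affine g -> affine h -> affine (fun x => g x + h x).
Proof.
move=> [r [c hg]] [s [e hh]]; exists (fun j => r j + s j), (c + e) => x.
rewrite hg hh addrACA -big_split; congr (_ + _).
by apply: eq_bigr => j _; symmetry; exact: scalerDl.
Qed.

Lemma affineZ m (g : 'rV[M]_m -> M) (a : R) :
  affine g -> affine (fun x => rscale (g x) a).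
Proof.
move=> [r [c hg]]; exists (fun j => r j * a), (rscale c a) => x.
rewrite hg /rscale scalerDr scaler_sumr; congr (_ + _).
by apply: eq_bigr => j _; rewrite scalerA.
Qed.

Lemma affineN m (g : 'rV[M]_m -> M) : affine g -> affine (fun x => - g x).
Proof.
move=> /(affineZ (-1)); apply: affine_ext => x; exact: scaleN1r.
Qed.

Lemma affine_sum m (I : Type) (s : seq I) (g : I -> 'rV[M]_m -> M) :
  (forall i, affine (g i)) -> affine (fun x => \sum_(i <- s) g i x).
Proof.
move=> hg; elim: s => [|i s IHs].
  by apply: affine_ext (affine_cst _ 0) => x; rewrite big_nil.
by apply: affine_ext (affineD (hg i) IHs) => x; rewrite big_cons.
Qed.

Lemma affine_comp m n (g : 'rV[M]_n -> M) (h : 'rV[M]_m -> 'rV[M]_n) :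
  affine g -> affine_map h -> affine (fun x => g (h x)).
Proof.
move=> [r [c hg]] hh.
apply: (@affine_ext _ (fun x => \sum_j rscale (h x 0 j) (r j) + c)) => //.
apply: affineD (affine_cst _ _).
by apply: affine_sum => j; apply: affineZ.
Qed.

Lemma affine_map_id m : affine_map (fun x : 'rV[M]_m => x).
Proof. by move=> j; exact: affine_coord. Qed.

Lemma affine_map_cst m n (a : 'rV[M]_n) : affine_map (fun _ : 'rV[M]_m => a).
Proof. by move=> j; exact: affine_cst. Qed.

Lemma affine_map_lsub m n : affine_map (fun x : 'rV[M]_(m + n) => lsubmx x).
Proof.
by move=> j; apply: affine_ext (affine_coord (lshift n j)) => x; rewrite mxE.
Qed.

Lemma affine_map_rsub m n : affine_map (fun x : 'rV[M]_(m + n) => rsubmx x).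
Proof.
by move=> j; apply: affine_ext (affine_coord (rshift m j)) => x; rewrite mxE.
Qed.

Lemma affine_map_row m n p (g : 'rV[M]_m -> 'rV[M]_n) (h : 'rV[M]_m -> 'rV[M]_p) :
  affine_map g -> affine_map h -> affine_map (fun x => row_mx (g x) (h x)).
Proof.
move=> hg hh j; case: (fintype.splitP j) => k ek.
  have -> : j = lshift p k by exact: val_inj.
  by apply: affine_ext (hg k) => x; rewrite row_mxEl.
have -> : j = rshift n k by exact: val_inj.
by apply: affine_ext (hh k) => x; rewrite row_mxEr.
Qed.

Lemma affine_map_comp m n p (g : 'rV[M]_n -> 'rV[M]_p)
    (h : 'rV[M]_m -> 'rV[M]_n) :
  affine_map g -> affine_map h -> affine_map (fun x => g (h x)).
Proof. by move=> hg hh j; exact: affine_comp (hg j) hh. Qed.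

(** With its converse [pp_set_affine], this replaces matrices by vanishing affine functions indexed
    by any finite type: a sum type for an intersection, composition for a substitution. *)
Lemma pp_set_affineP m (A : set 'rV[M]_m) : pp_set A ->
  exists (l : nat) (I : finType) (g : I -> 'rV[M]_(m + l) -> M),
    (forall i, affine (g i)) /\
    forall x, A x <-> exists y, forall i, g i (row_mx x y) = 0.
Proof.
move=> [l [t [r [s [c ->]]]]].
exists l, 'I_t, (fun i z => \sum_j rscale (lsubmx z 0 j) (r i j)
  + \sum_k rscale (rsubmx z 0 k) (s i k) + c 0 i); split=> [i|x].
  apply: affineD (affine_cst _ _); apply: affineD; apply: affine_sum => j;
    apply: affineZ; [exact: affine_map_lsub|exact: affine_map_rsub].
by split=> [[y hy]|[y hy]]; exists y => i; move: (hy i);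
  rewrite row_mxKl row_mxKr.
Qed.

Lemma pp_set_affine m l (I : finType) (g : I -> 'rV[M]_(m + l) -> M) :
  (forall i, affine (g i)) ->
  pp_set [set x : 'rV[M]_m | exists y, forall i, g i (row_mx x y) = 0].
Proof.
move=> /choice[r] /choice[c hg].
exists l, #|I|, (\matrix_(i, j) r (enum_val i) (lshift l j)),
  (\matrix_(i, j) r (enum_val i) (rshift m j)), (\row_i c (enum_val i)).
have E x y (i : 'I_#|I|) : g (enum_val i) (row_mx x y) =
    \sum_j rscale (x 0 j) ((\matrix_(i, j) r (enum_val i) (lshift l j)) i j) +
    \sum_k rscale (y 0 k) ((\matrix_(i, j) r (enum_val i) (rshift m j)) i k) +
    (\row_i c (enum_val i)) 0 i.
  rewrite hg big_split_ord mxE; congr (_ + _ + _); apply: eq_bigr => j _;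
    by rewrite ?row_mxEl ?row_mxEr mxE.
apply/seteqP; split=> x [y hy]; exists y => i; first by rewrite -E; exact: hy.
by have := hy (enum_rank i); rewrite -E enum_rankK.
Qed.

Lemma pp_set_ext m (A B : set 'rV[M]_m) :
  (forall x, A x <-> B x) -> pp_set A -> pp_set B.
Proof. by move=> AB; have -> : B = A by apply/seteqP; split=> x /AB. Qed.

Lemma pp_preimage m n (A : set 'rV[M]_n) (h : 'rV[M]_m -> 'rV[M]_n) :
  affine_map h -> pp_set A -> pp_set (h @^-1` A).
Proof.
move=> hh /pp_set_affineP[l [I [g [hg hA]]]].
pose g' i (z : 'rV[M]_(m + l)) := g i (row_mx (h (lsubmx z)) (rsubmx z)).
apply: pp_set_ext (@pp_set_affine m l I g' _) => [x|i].
  rewrite /preimage /= hA; split=> [[y hy]|[y hy]]; exists y => i;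
    by have := hy i; rewrite /g' row_mxKl row_mxKr.
apply: affine_comp => //; apply: affine_map_row; last exact: affine_map_rsub.
by apply: affine_map_comp => //; exact: affine_map_lsub.
Qed.

Definition lproj m n (A : set 'rV[M]_(m + n)) : set 'rV[M]_m :=
  [set x | exists y, A (row_mx x y)].

Lemma pp_lproj m n (A : set 'rV[M]_(m + n)) : pp_set A -> pp_set (lproj A).
Proof.
move=> /pp_set_affineP[l [I [g [hg hA]]]].
pose g' i (z : 'rV[M]_(m + (n + l))) :=
  g i (row_mx (row_mx (lsubmx z) (lsubmx (rsubmx z))) (rsubmx (rsubmx z))).
apply: pp_set_ext (@pp_set_affine m (n + l) I g' _) => [x|i].
  split=> [[u hu]|[y /hA[u hu]]].
    exists (lsubmx u); apply/hA; exists (rsubmx u) => i.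
    by have := hu i; rewrite /g' row_mxKl row_mxKr.
  exists (row_mx y u) => i.
  by rewrite /g' row_mxKl !row_mxKr row_mxKl.
have hl : affine_map (fun z : 'rV[M]_(m + (n + l)) => lsubmx z).
  exact: affine_map_lsub.
have hr : affine_map (fun z : 'rV[M]_(m + (n + l)) => rsubmx z).
  exact: affine_map_rsub.
apply: affine_comp => //; apply: affine_map_row; last first.
  by apply: affine_map_comp hr; exact: affine_map_rsub.
apply: affine_map_row => //.
by apply: affine_map_comp hr; exact: affine_map_lsub.
Qed.

Lemma pp_eq0 m (g : 'rV[M]_m -> M) : affine g -> pp_set [set x | g x = 0].
Proof.
move=> hg; pose g' (i : unit) (z : 'rV[M]_(m + 0)) := g (lsubmx z).
apply: pp_set_ext (@pp_set_affine m 0 _ g' _) => [x|i].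
  split=> [[y /(_ tt)]|/= gx]; first by rewrite /g' row_mxKl.
  by exists 0 => i; rewrite /g' row_mxKl.
by apply: affine_comp => //; exact: affine_map_lsub.
Qed.

Lemma pp_setI m (A B : set 'rV[M]_m) : pp_set A -> pp_set B -> pp_set (A `&` B).
Proof.
move=> /pp_set_affineP[l [I [g [hg hA]]]] /pp_set_affineP[k [J [h [hh hB]]]].
pose g' (i : I + J) (z : 'rV[M]_(m + (l + k))) :=
  match i with
  | inl i => g i (row_mx (lsubmx z) (lsubmx (rsubmx z)))
  | inr j => h j (row_mx (lsubmx z) (rsubmx (rsubmx z)))
  end.
apply: pp_set_ext (@pp_set_affine m (l + k) _ g' _) => [x|].
  split=> [[u hu]|[/hA[y hy] /hB[z hz]]].
    split; [apply/hA; exists (lsubmx u) => i|apply/hB; exists (rsubmx u) => j].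
      by have := hu (inl i); rewrite /g' row_mxKl row_mxKr.
    by have := hu (inr j); rewrite /g' row_mxKl row_mxKr.
  exists (row_mx y z) => -[i|j] /=.
    by rewrite row_mxKr !row_mxKl.
  by rewrite row_mxKl !row_mxKr.
have hl : affine_map (fun z : 'rV[M]_(m + (l + k)) => lsubmx z).
  exact: affine_map_lsub.
have hr : affine_map (fun z : 'rV[M]_(m + (l + k)) => rsubmx z).
  exact: affine_map_rsub.
case=> [i|j]; apply: affine_comp => //; apply: affine_map_row => //.
  by apply: affine_map_comp hr; exact: affine_map_lsub.
by apply: affine_map_comp hr; exact: affine_map_rsub.
Qed.

Lemma pp_setT m : pp_set (setT : set 'rV[M]_m).
Proof. by apply: pp_set_ext (pp_eq0 (affine_cst m 0)) => x; split. Qed.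

Lemma pp_bigcap m (I : choiceType) (s : {fset I}) (A : I -> set 'rV[M]_m) :
  (forall i, i \in s -> pp_set (A i)) ->
  pp_set (\bigcap_(i in [set` s]) A i).
Proof.
move=> hA.
suff: forall r : seq I, {subset r <= s} ->
    pp_set [set x | forall i, i \in r -> A i x].
  by move=> /(_ (enum_fset s)) h; apply: pp_set_ext (h _).
elim=> [_|i r IHr rs]; first by apply: pp_set_ext (pp_setT m) => x; split.
have ppr := IHr (fun j jr => rs j (@mem_behead _ (i :: r) j jr)).
apply: pp_set_ext (pp_setI (hA i (rs i (mem_head i r))) ppr) => x; split.
  by move=> [Ai Ar] j; rewrite inE => /orP[/eqP->|/Ar].
by move=> h; split=> [|j jr]; apply: h; rewrite inE ?eqxx ?jr ?orbT.
Qed.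

Lemma pp_eq_map m n (g h : 'rV[M]_m -> 'rV[M]_n) :
  affine_map g -> affine_map h -> pp_set [set x | g x = h x].
Proof.
move=> hg hh.
have ppj j : pp_set [set x | g x 0 j - h x 0 j = 0].
  by apply: pp_eq0; exact: affineD (hg j) (affineN (hh j)).
apply: pp_set_ext (@pp_bigcap m _ [fset j in enum 'I_n]%fset _ (fun j _ => ppj j)).
move=> x; split=> [e|/= gh j _]; last by rewrite /= gh subrr.
apply/rowP => j; apply/eqP; rewrite -subr_eq0; apply/eqP.
by apply: e; rewrite /= !inE mem_enum.
Qed.

(** Closure under [x - y + z] expresses that [A] is a coset, without choosing a subgroup. *)
Lemma pp_set_maltsev m (A : set 'rV[M]_m) x y z :
  pp_set A -> A x -> A y -> A z -> A (x - y + z).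
Proof.
move=> /pp_set_coset[d hd] Ax Ay Az; apply/(hd z) => //.
by rewrite addrK; apply/hd.
Qed.

End Affine.

(** * Constructible sets and quantifier elimination *)

Section FiniteFamilies.
Variable T : choiceType.
Implicit Types (F G : {fset set T}) (A B : set T).

(** Induction on the number of members of [F] strictly above [A]. *)
Lemma exists_maximal F A : A \in F ->
  exists B, [/\ B \in F, A `<=` B & forall E, E \in F -> B `<=` E -> E = B].
Proof.
pose above A := [fset E in F | `[< (A `<` E)%classic >]]%fset.
have [k] := ubnP #|` above A|; elim: k A => // k IHk A hk AF.
have [[E EF [AE nEA]]|nE] := pselect (exists2 E, E \in F & A `<` E); last first.
  exists A; split=> // E EF AE; apply: contrapT => ne; apply: nE.
  exists E => //; split=> // EA; apply: ne; exact/seteqP.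
have [|B [BF EB hB]] := IHk E _ EF.
  apply: (leq_trans (fproper_ltn_card _) (_ : #|` above A| <= k)%N) => //.
  rewrite fproperE; apply/andP; split.
    apply/fsubsetP => C; rewrite !inE => /andP[-> /asboolP[EC nCE]].
    apply/asboolP; split; first exact: subset_trans AE EC.
    by move=> CA; apply: nCE; exact: subset_trans CA AE.
  apply/negP => /fsubsetP/(_ E); rewrite !inE EF /=.
  by move=> /(_ (asboolT (conj AE nEA)))/asboolP[_]; exact.
by exists B; split=> //; exact: subset_trans AE EB.
Qed.

(** The choice [g = fset0] is allowed, so the whole space is always a member and every point lies in
    a smallest member. *)
Definition cap_closure F : {fset set T} :=
  [fset (\bigcap_(A in [set` (g : {fset set T})]) A)%classic | g in fpowerset F]%fset.

Lemma cap_closureP F A :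
  reflect (exists2 g : {fset set T}, {subset g <= F} & A = \bigcap_(B in [set` g]) B)
    (A \in cap_closure F).
Proof.
apply: (iffP (imfsetP _ _ _ _)) => -[g /= hg ->]; exists g => //.
  by move: hg; rewrite fpowersetE => /fsubsetP.
by rewrite fpowersetE; exact/fsubsetP.
Qed.

Lemma cap_closureI F A B :
  A \in cap_closure F -> B \in cap_closure F -> A `&` B \in cap_closure F.
Proof.
move=> /cap_closureP[g hg ->] /cap_closureP[h hh ->]; apply/cap_closureP.
exists (g `|` h)%fset; first by move=> C; rewrite inE => /orP[/hg|/hh].
by rewrite -bigcap_setU; congr bigcap; apply/seteqP; split=> C /=;
  rewrite inE => /orP.
Qed.

Lemma sub_cap_closure F A : A \in F -> A \in cap_closure F.
Proof.
move=> AF; apply/cap_closureP; exists [fset A]%fset.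
  by move=> B; rewrite inE => /eqP->.
by apply/seteqP; split=> [x Ax B /=|x]; [rewrite inE => /eqP->|apply; rewrite /= inE].
Qed.

(** For [A] in [cap_closure F], these are the points whose smallest member of [cap_closure F] is
    [A]; such points belong to the same members of [F]. *)
Definition stratum F A : set T :=
  A `\` \bigcup_(B in [set B | B \in cap_closure F /\ B `<` A]) B.

(** As [F] is finite, these are the sets in the Boolean algebra generated by [F]. *)
Definition measurable_for F (D : set T) : Prop :=
  forall x y, (forall A, A \in F -> A x <-> A y) -> D x -> D y.

(** [A] is the intersection of the members of [F] containing [x]. A point of its stratum lies in no
    further member of [F], since intersecting with that member would give something strictly
    smaller. *)
Lemma stratum_cover F (D : set T) x : measurable_for F D -> D x ->
  exists A, [/\ A \in cap_closure F, stratum F A x & stratum F A `<=` D].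
Proof.
move=> hD Dx; pose g := [fset A in F | `[< A x >]]%fset.
have gF : \bigcap_(B in [set` g]) B \in cap_closure F.
  by apply/cap_closureP; exists g => // A; rewrite !inE => /andP[].
have capx : (\bigcap_(B in [set` g]) B) x.
  by move=> B; rewrite /= !inE => /andP[_ /asboolP].
exists (\bigcap_(B in [set` g]) B); split=> //.
  split=> // -[_ /= [/cap_closureP[h hh ->] [_ nsub]] hx].
  apply: nsub => y gy B hB; apply: gy; rewrite /= !inE hh //=.
  by apply/asboolP; exact: hx.
move=> y [gy nstr]; apply: hD Dx => A AF; split=> [Ax|Ay].
  by apply: gy; rewrite /= !inE AF /=; exact/asboolP.
apply: contrapT => nAx; apply: nstr.
exists (\bigcap_(B in [set` g]) B `&` A) => //=; split.
  by apply: cap_closureI gF _; exact: sub_cap_closure.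
by split=> [|h]; [exact: subIsetl | apply: nAx; apply: (h x capx).2].
Qed.

Lemma stratum_disjoint F A B x : A \in cap_closure F -> B \in cap_closure F ->
  stratum F A x -> stratum F B x -> A = B.
Proof.
move=> AF BF [Ax nA] [Bx nB]; apply/seteqP; split; apply: contrapT => ns.
  apply: nA; exists (A `&` B) => //=; split; first exact: cap_closureI.
  by split; [exact: subIsetl | move=> h; apply: ns => y /h[]].
apply: nB; exists (A `&` B) => //=; split; first exact: cap_closureI.
by split; [exact: subIsetr | move=> h; apply: ns => y /h[]].
Qed.

End FiniteFamilies.

(** * Boolean combinations of pp-sets and elimination of quantifiers *)

Section Constructible.
Variables (R : pzRingType) (M : lmodType R^c).

(** This semantic form of a Boolean combination makes complements immediate: the same [F] serves. *)
Definition constructible n (D : set 'rV[M]_n) : Prop :=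
  exists F : {fset set 'rV[M]_n},
    (forall A, A \in F -> pp_set A) /\ measurable_for F D.

Lemma constructible_pp n (A : set 'rV[M]_n) : pp_set A -> constructible A.
Proof.
move=> hA; exists [fset A]%fset; split=> [B|x y h Ax].
  by rewrite inE => /eqP->.
by apply/(h A) => //; rewrite inE.
Qed.

Lemma constructible_setC n (D : set 'rV[M]_n) :
  constructible D -> constructible (~` D).
Proof.
move=> [F [ppF hF]]; exists F; split=> // x y h nDx Dy; apply: nDx.
by apply: hF Dy => A AF; rewrite h.
Qed.

Lemma constructible_setI n (D E : set 'rV[M]_n) :
  constructible D -> constructible E -> constructible (D `&` E).
Proof.
move=> [F [ppF hF]] [G [ppG hG]]; exists (F `|` G)%fset; split=> [A|x y h].
  by rewrite inE => /orP[/ppF|/ppG].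
move=> [Dx Ex]; split.
  by apply: hF Dx => A AF; apply: h; rewrite inE AF.
by apply: hG Ex => A AG; apply: h; rewrite inE AG orbT.
Qed.

Lemma constructible_preimage m n (D : set 'rV[M]_n)
    (h : 'rV[M]_m -> 'rV[M]_n) :
  affine_map h -> constructible D -> constructible (h @^-1` D).
Proof.
move=> hh [F [ppF hF]]; exists [fset h @^-1` A | A in F]%fset; split=> [B|x y e].
  by move=> /imfsetP[A /= /ppF ppA ->]; exact: pp_preimage.
apply: hF => A AF; apply: (e (h @^-1` A)).
by apply/imfsetP; exists A.
Qed.

Lemma pp_cap_closure n (F : {fset set 'rV[M]_n}) A :
  (forall A, A \in F -> pp_set A) -> A \in cap_closure F -> pp_set A.
Proof.
by move=> ppF /cap_closureP[g gF ->]; apply: pp_bigcap => B /gF /ppF.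
Qed.

Variable hM : theory_stable M.

Lemma pp_irreducible n (A : set 'rV[M]_n) (F : {fset set 'rV[M]_n}) :
  pp_set A -> A !=set0 -> (forall B, B \in F -> pp_set B) ->
  A `<=` \bigcup_(B in [set` F]) B -> exists2 B, B \in F & A `<=` B.
Proof.
move=> ppA A0 ppF AF.
have [||[B BF] /= AB] :=
  pp_set_irreducible (I := F) (B := fun i => fsval i) hM ppA A0.
- by move=> i; exact: ppF (fsvalP i).
- by move=> x /AF[B BF Bx]; exists [` BF]%fset.
by exists B.
Qed.

Lemma stratum_nonempty n (F : {fset set 'rV[M]_n}) A :
  (forall B, B \in F -> pp_set B) -> A \in cap_closure F -> A !=set0 ->
  stratum F A !=set0.
Proof.
move=> ppF AF A0; apply: contrapT => ns.
have [||||B] := @pp_irreducible n A [fset B in cap_closure F | `[< (B `<` A)%classic >]]%fset.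
- exact: pp_cap_closure AF.
- exact: A0.
- by move=> B; rewrite !inE => /andP[BF _]; exact: pp_cap_closure BF.
- move=> x Ax; apply: contrapT => nx; apply: ns; exists x; split=> //.
  move=> -[B [BF BA] Bx]; apply: nx; exists B => //=; rewrite !inE BF /=.
  exact/asboolP.
- by rewrite !inE => /andP[_ /asboolP[_ nAB]] /nAB.
Qed.

(* By the coset structure, if some fibre of [A] lies in the pp-subset [B] and
   is nonempty, then so does every fibre of [A] that meets [B]. *)
Lemma constructible_lproj m n (D : set 'rV[M]_(m + n)) :
  constructible D -> constructible (lproj D).
Proof.
move=> [F [ppF hF]]; exists [fset lproj A | A in cap_closure F]%fset; split.
  by move=> _ /imfsetP[A /= AF ->]; apply/pp_lproj; exact: pp_cap_closure AF.
move=> x x' e [y Dy].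
have [A [AF [Axy nA] AD]] := stratum_cover hF Dy.
have e' B : B \in cap_closure F -> lproj B x <-> lproj B x'.
  by move=> BF; apply: e; apply/imfsetP; exists B.
have ppA := pp_cap_closure ppF AF.
pose Ax' := A `&` [set z | lsubmx z = x'].
have ppAx' : pp_set Ax'.
  apply: pp_setI => //; apply: pp_eq_map; first exact: affine_map_lsub.
  exact: affine_map_cst.
have [y1 Ay1] : lproj A x' by apply/e' => //; exists y.
apply: contrapT => nD.
(* If [D] had no point over [x'], the fibre of [A] there would miss the stratum, hence be covered by
   members of [cap_closure F] strictly inside [A]. *)
have [||||B] :=
  @pp_irreducible _ Ax' [fset B in cap_closure F | `[< (B `<` A)%classic >]]%fset.
- exact: ppAx'.
- by exists (row_mx x' y1); split=> //=; rewrite row_mxKl.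
- by move=> B; rewrite !inE => /andP[BF _]; exact: pp_cap_closure BF.
- move=> z [Az zx']; apply: contrapT => nz; apply: nD.
  exists (rsubmx z); apply: AD; rewrite -zx' hsubmxK; split=> // -[B [BF BA] Bz].
  by apply: nz; exists B => //=; rewrite !inE BF /=; exact/asboolP.
rewrite !inE => /andP[BF /asboolP BA] AB; apply: nA; exists B => //.
have ppB := pp_cap_closure ppF BF.
have Bx'y1 : B (row_mx x' y1) by apply: AB; split=> //=; rewrite row_mxKl.
have [u Bu] : lproj B x by apply/e' => //; exists y1.
(* The point [(x, y)] is moved along a difference of two points of [B] into the fibre over [x'],
   which lies in [B], and is then moved back. *)
have Bw : B (row_mx x y - row_mx x u + row_mx x' y1).
  apply: AB; split; first by apply: pp_set_maltsev => //; exact: BA.1 _ Bu.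
  by rewrite /= opp_row_mx !add_row_mx subrr add0r row_mxKl.
have := pp_set_maltsev ppB Bw Bx'y1 Bu.
by rewrite addrK subrK.
Qed.

Lemma affine_eval n (t : term R n) : affine (fun x : 'rV[M]_n => eval x t).
Proof.
elim: t => /= [i||u hu v hv|u hu|u hu r].
- exact: affine_coord.
- exact: affine_cst.
- exact: affineD.
- exact: affineN.
- exact: affineZ.
Qed.

(** Quantifier elimination down to Boolean combinations of pp-sets, in the spirit of Baur and Monk;
    the existential step is [constructible_lproj]. *)
Lemma constructible_holds n (phi : formula R n) :
  constructible [set x : 'rV[M]_n | holds phi x].
Proof.
elim: phi => {n} [n t u|n phi IH|n phi IH psi IH'|n phi IH].
- apply: constructible_pp; apply: (@pp_set_ext _ _ _
    [set x | eval x t - eval x u = 0]).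
    by move=> x /=; split=> [/subr0_eq|->] //; rewrite subrr.
  apply: pp_eq0; apply: affineD; first exact: affine_eval.
  by apply: affineN; exact: affine_eval.
- exact: constructible_setC.
- exact: constructible_setI.
have := constructible_lproj IH; congr constructible.
apply/seteqP; split=> x /= [a ha]; last by exists (const_mx a).
exists (a 0 0); rewrite (_ : const_mx _ = a) //.
by apply/rowP => i; rewrite mxE ord1.
Qed.

Lemma definable_constructible n (D : set 'rV[M]_n) :
  definable D -> constructible D.
Proof.
move=> [k [phi [c ->]]].
apply: (constructible_preimage _ (constructible_holds phi)).
apply: affine_map_row; first exact: affine_map_id.
exact: affine_map_cst.
Qed.

End Constructible.

(** * Integer combinations of pp-sets *)

Section Alternating.
Variable T : choiceType.

(** Adding or removing a fixed [t] with [Q t] is a sign-reversing involution of the index sets, so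
    the sum equals its own negative. Without such a [t], only [fset0] contributes. *)
Lemma alternating_sum (a : {fset T}) (Q : pred T) :
  \sum_(g <- fpowerset a | all Q (g : {fset T})) (-1) ^+ #|` g|
  = (~~ has Q a)%:R :> int.
Proof.
have [/hasP[t ta Qt]|nQ] := boolP (has Q a); last first.
  rewrite (big_rem fset0) /=; last by rewrite fpowersetE fsub0set.
  rewrite expr0 big1_seq ?addr0// => g /andP[Qg].
  rewrite rem_filter ?fset_uniq// mem_filter /= fpowersetE => /andP[g0 ga].
  case/fset0Pn: g0 => u ug; case/negP: nQ; apply/hasP; exists u.
    exact: fsubsetP ga u ug.
  exact: allP Qg u ug.
pose tog (g : {fset T}) := if t \in g then (g `\ t)%fset else (t |` g)%fset.
have togK : involutive tog.
  move=> g; rewrite /tog; case: (boolP (t \in g)) => tg.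
    by rewrite !inE eqxx /= fsetD1K.
  by rewrite !inE eqxx /= fsetU1K.
set S := (LHS); suff: S = - S by lia.
rewrite {1}/S (perm_big (map tog (fpowerset a))) /=; last first.
  apply: uniq_perm; rewrite ?map_inj_uniq ?fset_uniq//; first exact: inv_inj.
  move=> g; rewrite -[g in RHS]togK (mem_map (inv_inj togK)).
  rewrite !fpowersetE /tog; case: ifP => tg; apply/fsubsetP/fsubsetP => h u.
    - by rewrite inE => /andP[_]; exact: h.
    - by case: (eqVneq u t) => [->//|ut] ug; apply: h; rewrite !inE ut.
    - by rewrite !inE => /orP[/eqP->//|]; exact: h.
    - by move=> ug; apply: h; rewrite !inE ug orbT.
rewrite big_map /S -sumrN; apply: eq_big => [g|g _].
  rewrite /tog; case: ifP => tg; apply/allP/allP => h u.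
  - by case: (eqVneq u t) => [->//|ut] ug; apply: h; rewrite !inE ut.
  - by rewrite inE => /andP[_]; exact: h.
  - by move=> ug; apply: h; rewrite !inE ug orbT.
  - by rewrite !inE => /orP[/eqP->//|]; exact: h.
rewrite /tog; case: ifPn => tg.
  by rewrite [in RHS](cardfsD1 t) tg exprS mulN1r opprK.
by rewrite cardfsU1 tg exprS mulN1r.
Qed.

Lemma alternating_sum_ne (a : {fset T}) (Q : pred T) :
  \sum_(g <- fpowerset a | (g != fset0) && all Q (g : {fset T}))
    (-1) ^+ #|` g|.-1 = (has Q a)%:R :> int.
Proof.
have := alternating_sum a Q.
rewrite big_mkcond (bigD1_seq fset0) ?fset_uniq//=; last first.
  by rewrite fpowersetE fsub0set.
rewrite -big_mkcondr expr0 => h.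
have -> : (has Q a)%:R = 1 - (~~ has Q a)%:R :> int by case: has.
rewrite -h opprD addrA subrr add0r -sumrN.
apply: eq_bigr => g /andP[g0 _].
by case: #|` g| (cardfs_eq0 g) => [|k _]; rewrite ?(negPf g0)//= exprS mulN1r opprK.
Qed.

(** Each face is counted in exactly one dimension, below the number of vertices. The empty set is
    excluded because the truncated predecessor would give it the weight 1, while [simplicial_chi]
    ignores it. *)
Lemma simplicial_chiE (K : {fset {fset T}}) : fset0 \notin K ->
  simplicial_chi K = \sum_(g <- K) (-1) ^+ #|` g|.-1.
Proof.
move=> K0; rewrite /simplicial_chi; set m := #|` _|.
have hm g : g \in K -> (#|` g|.-1 < m)%N.
  move=> gK; have g0 : (0 < #|` g|)%N.
    by rewrite cardfs_gt0; apply: contraNneq K0 => <-.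
  rewrite prednK //; apply: fsubset_leq_card; exact: bigfcup_sup.
transitivity (\sum_(k < m) \sum_(g <- K | #|` g| == k.+1) (-1) ^+ k : int).
  apply: eq_bigr => k _; rewrite big_const_seq iter_addr_0 -mulr_natr natz.
  congr (_ * Posz _).
  by rewrite -size_filter; apply: perm_size; apply: uniq_perm;
    rewrite ?filter_uniq ?fset_uniq// => g; rewrite mem_filter !inE andbC.
rewrite (exchange_big_dep xpredT) //=; apply: eq_big_seq => g gK.
have g0 : (0 < #|` g|)%N.
  by rewrite cardfs_gt0; apply: contraNneq K0 => <-.
rewrite (big_pred1 (Ordinal (hm g gK))) //= => k.
by rewrite /pred1 /= -val_eqE /= -{1}(prednK g0) eqSS eq_sym.
Qed.

End Alternating.

Section Combinations.
Variables (R : pzRingType) (M : lmodType R^c) (n : nat).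
Local Notation V := 'rV[M]_n.
Implicit Types (P A B D : set V) (L : seq (int * set V)) (a : {fset set V}).

(** The value at a point, the coefficient of a set and the total over a colour are all of this form,
    for different [Q]. A set may occur several times in [L]. *)
Definition sumon L (Q : pred (set V)) : int := \sum_(p <- L | Q p.2) p.1.

Definition comb_val L (x : V) : int := sumon L (fun A => `[< A x >]).

Definition coef L P : int := sumon L (fun A => A == P).

Definition opp_comb L := [seq (- p.1, p.2) | p <- L].

Definition ne_comb L : Prop := forall p, p \in L -> pp_set_ne p.2.

Lemma sumon_cat L L' Q : sumon (L ++ L') Q = sumon L Q + sumon L' Q.
Proof. by rewrite /sumon big_cat. Qed.

Lemma sumon_opp L Q : sumon (opp_comb L) Q = - sumon L Q.
Proof. by rewrite /sumon big_map sumrN. Qed.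

Lemma eq_sumon L Q Q' : (forall p, p \in L -> Q p.2 = Q' p.2) ->
  sumon L Q = sumon L Q'.
Proof.
move=> e; rewrite /sumon big_seq_cond [RHS]big_seq_cond.
by apply: eq_bigl => p; case: (boolP (p \in L)) => //= /e.
Qed.

Lemma sumon_coef L Q (S : {fset set V}) : (forall p, p \in L -> p.2 \in S) ->
  sumon L Q = \sum_(P <- S | Q P) coef L P.
Proof.
move=> LS; rewrite /coef /sumon (exchange_big_dep (fun p => Q p.2)) /=; last first.
  by move=> P p QP /eqP->.
rewrite big_seq_cond [RHS]big_seq_cond; apply: eq_bigr => p /andP[pL Qp].
rewrite (big_rem p.2) ?LS//= Qp eqxx big1_seq ?addr0// => P.
rewrite rem_filter ?fset_uniq// mem_filter /= => /andP[/andP[_ /eqP->]].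
by rewrite eqxx.
Qed.

Variable hM : theory_stable M.

(** By irreducibility [P] is not covered by the sets of [L] that fail to contain it; a point of [P]
    outside these lies in exactly the sets containing [P]. *)
Lemma generic_point L P : ne_comb L -> pp_set_ne P ->
  exists x, comb_val L x = sumon L (fun A => `[< P `<=` A >]).
Proof.
move=> hL [ppP P0].
pose F := [fset p.2 | p in L & ~~ `[< (P `<=` p.2)%classic >]]%fset.
have [h|] := pselect (P `<=` \bigcup_(A in [set` F]) A).
  have [|A /imfsetP[p /=]] := pp_irreducible hM ppP P0 _ h.
    by move=> A /imfsetP[p /=]; rewrite inE => /andP[/hL[ppA _] _] ->.
  by rewrite inE => /andP[_ /asboolP np] -> /np.
move=> /existsNP[x /not_implyP[Px nx]]; exists x; apply: eq_sumon => p pL.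
apply/asboolP/asboolP => [px|]; last exact.
apply: contrapT => np; apply: nx; exists p.2 => //=.
by apply/imfsetP; exists p => //=; rewrite inE pL; exact/asboolP.
Qed.

Lemma coef_notin L P : (forall p, p \in L -> p.2 != P) -> coef L P = 0.
Proof.
by move=> h; rewrite /coef /sumon big_seq_cond big1// => p /andP[/h/negPf->].
Qed.

(** Induction on the number of sets of [L] strictly above [P]. At a generic point of [P] the value
    is the sum of the coefficients of the sets containing [P], and all but that of [P] vanish
    already. *)
Lemma coef_val0 L : ne_comb L -> (forall x, comb_val L x = 0) ->
  forall P, coef L P = 0.
Proof.
move=> hL v0 P; pose S := [fset p.2 | p in L]%fset.
have LS p : p \in L -> p.2 \in S by move=> pL; apply/imfsetP; exists p.
pose above A := [fset E in S | `[< (A `<` E)%classic >]]%fset.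
have [k] := ubnP #|` above P|; elim: k P => // k IHk P hk.
have [PS|PS] := boolP (P \in S); last first.
  by apply: coef_notin => p /LS; apply: contraTneq => ->.
have neP : pp_set_ne P by move: PS => /imfsetP[p /= /hL hp ->].
have [x] := generic_point hL neP; rewrite v0 (sumon_coef _ LS).
rewrite big_mkcond (bigD1_seq P) ?fset_uniq//= asboolT//.
rewrite big1_seq ?addr0// => E /andP[nEP ES]; case: asboolP => // PE.
have PEp : P `<` E.
  by split=> // EP; move: nEP; rewrite (_ : E = P) ?eqxx//; exact/seteqP.
apply: IHk; apply: leq_trans (_ : #|` above P| <= k)%N => //.
apply: fproper_ltn_card; rewrite fproperE; apply/andP; split.
  apply/fsubsetP => C; rewrite !inE => /andP[-> /asboolP[EC nCE]].
  apply/asboolP; split; first exact: subset_trans PE EC.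
  by move=> CP; apply: nCE; exact: subset_trans CP PE.
apply/negP => /fsubsetP/(_ E); rewrite !inE ES /=.
by move=> /(_ (asboolT PEp))/asboolP[_]; exact.
Qed.

Lemma coef_unique L L' P : ne_comb L -> ne_comb L' ->
  (forall x, comb_val L x = comb_val L' x) -> coef L P = coef L' P.
Proof.
move=> hL hL' e; apply/eqP; rewrite -subr_eq0 -sumon_opp -sumon_cat; apply/eqP.
apply: coef_val0 => [p|x].
  rewrite mem_cat => /orP[/hL//|/mapP[q /hL' hq ->]].
  exact: hq.
by rewrite /comb_val sumon_cat sumon_opp -!/(comb_val _ _) e subrr.
Qed.

(** Inclusion-exclusion for the indicator of the union of [a]. Empty intersections contribute
    nothing and are dropped so that only nonempty pp-sets occur. *)
Definition union_comb a : seq (int * set V) :=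
  [seq ((-1) ^+ #|` g|.-1, \bigcap_(A in [set` g]) A)
     | g : {fset set V} <- fpowerset a
     & (g != fset0) && `[< \bigcap_(A in [set` g]) A !=set0 >]].

Lemma union_combE a Q : sumon (union_comb a) Q =
  \sum_(g <- fpowerset a | [&& g != fset0,
     `[< \bigcap_(A in [set` (g : {fset set V})]) A !=set0 >]
      & Q (\bigcap_(A in [set` (g : {fset set V})]) A)]) (-1) ^+ #|` g|.-1.
Proof.
by rewrite /sumon big_map big_filter_cond /=; apply: eq_bigl => g; rewrite andbA.
Qed.

Lemma union_comb_ne a : (forall A, A \in a -> pp_set A) -> ne_comb (union_comb a).
Proof.
move=> ppa p /mapP[g]; rewrite mem_filter fpowersetE => /andP[/andP[_ /asboolP]].
move=> g0 /fsubsetP ga ->; split=> //; apply: pp_bigcap => A Ag.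
exact: ppa (ga A Ag).
Qed.

Lemma union_comb_sub a p : p \in union_comb a -> exists2 A, A \in a & p.2 `<=` A.
Proof.
move=> /mapP[g]; rewrite mem_filter fpowersetE => /andP[/andP[/fset0Pn[A Ag] _]].
move=> /fsubsetP ga ->; exists A; first exact: ga.
by move=> x; exact.
Qed.

Lemma all_bigcap (g : {fset set V}) (Q : set V -> Prop) :
  all (fun A => `[< Q A >]) g = `[< forall A, A \in g -> Q A >].
Proof.
apply/allP/asboolP => h A Ag; first exact/asboolP/h.
by apply/asboolP; exact: h.
Qed.

Lemma union_comb_val a x :
  comb_val (union_comb a) x = (`[< union_of a x >] : nat)%:Z.
Proof.
rewrite /comb_val union_combE.
transitivity ((has (fun A => `[< A x >]) a)%:R : int).
  rewrite -alternating_sum_ne; apply: eq_bigl => g; congr andb.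
  rewrite all_bigcap; apply/andP/asboolP => [[_ /asboolP h]|h]; first exact: h.
  by split; apply/asboolP => //; exists x.
rewrite natz; congr (Posz (nat_of_bool _)).
apply/hasP/asboolP => [[A Aa /asboolP Ax]|[A Aa Ax]]; exists A => //.
exact/asboolP.
Qed.

(** The nonempty [g] whose intersection contains [P] are the faces together with those whose
    intersection equals [P]. By [alternating_sum_ne] and irreducibility their total is [delta a P],
    so the second kind contributes [delta a P] minus the Euler characteristic. *)
Lemma union_comb_coef a P : (forall A, A \in a -> pp_set A) -> pp_set_ne P ->
  coef (union_comb a) P = - kappa_antichain P a.
Proof.
move=> ppa [ppP P0]; rewrite /coef union_combE /kappa_antichain opprB.
rewrite simplicial_chiE; last first.
  by rewrite !inE; apply/negP => /andP[_ /asboolP[]]; rewrite eqxx.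
have -> : delta a P =
    \sum_(g <- fpowerset a | (g != fset0) && all (fun A => `[< P `<=` A >]) g)
       (-1) ^+ #|` g|.-1.
  rewrite alternating_sum_ne natz /delta; congr (Posz (nat_of_bool _)).
  apply/asboolP/hasP => [h|[A Aa /asboolP PA] x /PA]; last by exists A.
  have [A Aa PA] := pp_irreducible hM ppP P0 ppa h.
  by exists A => //; exact/asboolP.
rewrite [X in _ = X - _](bigID (fun g : {fset set V} => \bigcap_(A in [set` g]) A == P)) /=.
set S1 := (LHS); set S2 := (X in S1 = X + _ - _); set S3 := (X in _ + X - _).
have -> : S1 = S2.
  apply: eq_bigl => g; rewrite -andbA; congr andb; rewrite all_bigcap.
  apply/andP/andP => [[_ /eqP e]|[_ /eqP e]]; split; try exact/eqP.
    by apply/asboolP => A Ag x; rewrite -e; exact.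
  by apply/asboolP; rewrite e.
suff -> : S3 = \sum_(g <- local_complex P a) (-1) ^+ #|` g|.-1 by rewrite addrK.
rewrite /S3 -big_filter; apply: perm_big; apply: uniq_perm.
- by rewrite filter_uniq ?fset_uniq.
- exact: fset_uniq.
move=> g; rewrite mem_filter !inE all_bigcap.
apply/andP/andP => [[/andP[/andP[g0 /asboolP gP] gneP] ga]|[ga /asboolP[g0 gP gprop]]].
  split=> //; apply/asboolP; split=> //.
    by move=> A Ag; split; [move: ga; rewrite fpowersetE => /fsubsetP; exact|exact: gP].
  have sub : P `<=` \bigcap_(A in [set` g]) A by move=> x Px A /gP; exact.
  split=> // sub'; move/eqP: gneP; apply; exact/seteqP.
split=> //; rewrite g0 /=; apply/andP; split.
  by apply/asboolP => A /gP[].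
by apply/eqP => e; case: gprop => _; rewrite e; exact.
Qed.

End Combinations.

(** * Cells and blocks *)

Section Blocks.
Variables (R : pzRingType) (M : lmodType R^c) (n : nat).
Local Notation V := 'rV[M]_n.
Implicit Types (P A B C D : set V) (L : seq (int * set V)) (a b : {fset set V}).

Definition indicates L D : Prop :=
  forall x, comb_val L x = (`[< D x >] : nat)%:Z.

Variable hM : theory_stable M.

(** [A] is covered by [ab'.1] and [ab.2] together, hence lies in one of their members. A member of
    [ab.2] is impossible: it lies strictly inside a member of the antichain [ab.1]. *)
Lemma represents_dominated ab ab' C A :
  represents ab C -> represents ab' C -> A \in ab.1 ->
  exists2 A', A' \in ab'.1 & A `<=` A'.
Proof.
move=> [[ppa acha] [ppb _] ba CE] [[ppa' _] _ _ CE'] Aa.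
have [ppA A0] := ppa A Aa.
have [||B] := pp_irreducible hM (F := (ab'.1 `|` ab.2)%fset) ppA A0.
- by move=> B; rewrite inE => /orP[/ppa'[]|/ppb[]].
- move=> x Ax; have [[B Bb Bx]|nb] := pselect (union_of ab.2 x).
    by exists B => //=; rewrite inE (Bb : B \in _) orbT.
  have : C x by rewrite CE; split=> //; exists A.
  by rewrite CE' => -[[B Ba' Bx] _]; exists B => //=; rewrite inE (Ba' : B \in _).
rewrite inE => /orP[Ba' AB|/ba[A' A'a [BA' nA'B]] AB]; first by exists B.
have AA' : A = A' by apply: acha => //; exact: subset_trans AB BA'.
by case: nA'B; rewrite -AA'.
Qed.

Lemma represents_sub ab ab' C :
  represents ab C -> represents ab' C -> {subset ab.1 <= ab'.1}.
Proof.
move=> h h' A Aa.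
have [A' A'a' AA'] := represents_dominated h h' Aa.
have [A'' A''a A'A''] := represents_dominated h' h A'a'.
have eA : A = A''.
  by have [[_ ach] _ _ _] := h; apply: ach => //; exact: subset_trans AA' A'A''.
by rewrite (_ : A = A') //; apply/seteqP; split=> //; rewrite eA.
Qed.

Lemma cell_PN_represents C : cell C -> represents (cell_PN C) C.
Proof. by move=> hC; exact: (@xgetPex _ _ [set ab | represents ab C]). Qed.

(** [block] refers to the representation picked by [cell_PN], so the given one has to be compared
    with it; the two positive parts coincide. *)
Lemma represents_block A b C : represents ([fset A]%fset, b) C -> block C.
Proof.
move=> h; have hC : cell C by exists ([fset A]%fset, b).
split=> //; have h' := cell_PN_represents hC.
rewrite (_ : cell_P C = [fset A]%fset) ?cardfs1//.
apply/eqP; rewrite eqEfsubset; apply/andP; split; apply/fsubsetP.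
  exact: represents_sub h' h.
exact: represents_sub h h'.
Qed.

Definition cell_comb C : seq (int * set V) :=
  union_comb (cell_P C) ++ opp_comb (union_comb (cell_N C)).

Lemma cell_comb_ne C : cell C -> ne_comb (cell_comb C).
Proof.
move=> /cell_PN_represents[[ppP _] [ppN _] _ _] p; rewrite mem_cat.
case/orP=> [|/mapP[q]].
  by apply: union_comb_ne => A /ppP[].
move=> hq ->; apply: (@union_comb_ne _ _ _ (cell_N C)) (q) hq.
by move=> A /ppN[].
Qed.

Lemma cell_comb_val C : cell C -> indicates (cell_comb C) C.
Proof.
move=> /cell_PN_represents[_ _ ba CE] x.
rewrite /comb_val sumon_cat sumon_opp -!/(comb_val _ _) !union_comb_val.
rewrite {3}CE -/(cell_P C) -/(cell_N C).
have NP : union_of (cell_N C) x -> union_of (cell_P C) x.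
  by move=> [B /ba[A Aa [BA _]] Bx]; exists A => //; exact: BA.
case: (asboolP (union_of (cell_P C) x)) => hP;
  case: (asboolP (union_of (cell_N C) x)) => hN; case: asboolP => //.
- by case.
- by move=> h; exfalso; apply: h.
- by move/NP : hN.
- by move/NP : hN.
- by case.
Qed.

Lemma cell_comb_coef C P : cell C -> pp_set_ne P ->
  coef (cell_comb C) P = - kappa_cell P C.
Proof.
move=> /cell_PN_represents[[ppP _] [ppN _] _ _] neP.
rewrite /coef sumon_cat sumon_opp -!/(coef _ _) !union_comb_coef//.
- by rewrite opprK addrC; symmetry; exact: opprB.
- by move=> A /ppN[].
- by move=> A /ppP[].
Qed.

(** Prepares the use of [inj_on_generic]: an affine map injective on [C] is injective on [A] minus
    the members of [F], hence on [A] and on the smaller set [p.2]. *)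
Lemma cell_comb_sub C p : cell C -> p \in cell_comb C ->
  exists A (F : {fset set V}), [/\ pp_set_ne A, p.2 `<=` A,
    forall B, B \in F -> pp_set B /\ ~ A `<=` B
    & A `\` \bigcup_(B in [set` F]) B `<=` C].
Proof.
move=> /cell_PN_represents[[ppP achP] [ppN _] ba CE] hp.
have [A AP pA] : exists2 A, A \in cell_P C & p.2 `<=` A.
  move: hp; rewrite mem_cat => /orP[/union_comb_sub//|/mapP[q]].
  move=> /union_comb_sub[B BN qB] ->; have [A AP [BA _]] := ba B BN.
  by exists A => //; exact: subset_trans qB BA.
exists A, (cell_N C); split=> //; first exact: ppP.
  move=> B BN; split; first by have [] := ppN B BN.
  move=> AB; have [A' A'P [BA' nA'B]] := ba B BN.
  have AA' : A = A' by apply: achP => //; exact: subset_trans AB BA'.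
  by apply: nA'B; rewrite -AA'.
by move=> x [Ax nx]; rewrite CE; split=> //; exists A.
Qed.

Definition partition_comb (s : {fset set V}) : seq (int * set V) :=
  flatten [seq cell_comb B | B : set V <- s].

Lemma partition_combE s Q :
  sumon (partition_comb s) Q = \sum_(B <- s) sumon (cell_comb B) Q.
Proof. by rewrite /sumon big_flatten big_map. Qed.

Section Partition.
Variables (s : {fset set V}) (D : set V).
Variable hs : block_partition s D.

Lemma partition_comb_mem p : p \in partition_comb s ->
  exists B, [/\ B \in s, cell B & p \in cell_comb B].
Proof.
move=> /flatten_mapP[B Bs pB]; exists B; split=> //.
by have [/(_ B Bs)[]] := hs.
Qed.

Lemma partition_comb_ne : ne_comb (partition_comb s).
Proof. by move=> p /partition_comb_mem[B [_ hB]]; exact: cell_comb_ne. Qed.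

Lemma partition_comb_val : indicates (partition_comb s) D.
Proof.
move=> x; have [hb [covD triv _]] := hs.
rewrite /comb_val partition_combE.
transitivity (\sum_(B <- s) (`[< B x >] : nat)%:Z).
  by apply: eq_big_seq => B /hb[/cell_comb_val-/(_ x)].
have [Dx|nDx] := pselect (D x); last first.
  rewrite asboolF// big1_seq// => B /andP[_ Bs]; rewrite asboolF// => Bx.
  by apply: nDx; rewrite -covD; exists B.
have [B Bs Bx] : cover [set` s] id x by rewrite covD.
rewrite asboolT// (bigD1_seq B) ?fset_uniq//= asboolT// big1_seq ?addr0//.
move=> E /andP[EB Es]; rewrite asboolF// => Ex; case/eqP: EB.
by apply: triv => //; exists x.
Qed.

Lemma partition_comb_coef P : pp_set_ne P ->
  coef (partition_comb s) P = - \sum_(B <- s) kappa_cell P B.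
Proof.
move=> neP; rewrite /coef partition_combE -sumrN; apply: eq_big_seq => B Bs.
by apply: cell_comb_coef => //; have [/(_ B Bs)[]] := hs.
Qed.

Lemma partition_comb_sub p : p \in partition_comb s ->
  exists A (F : {fset set V}), [/\ pp_set_ne A, p.2 `<=` A,
    forall B, B \in F -> pp_set B /\ ~ A `<=` B
    & A `\` \bigcup_(B in [set` F]) B `<=` D].
Proof.
move=> /partition_comb_mem[C [Cs hC /(cell_comb_sub hC)[A [F [neA pA hF AC]]]]].
exists A, F; split=> //; apply: subset_trans AC _ => x Cx.
by have [_ [covD _ _]] := hs; rewrite -covD; exists C.
Qed.

End Partition.

Lemma stratum_block (F : {fset set V}) A : (forall B, B \in F -> pp_set B) ->
  A \in cap_closure F -> A !=set0 -> block (stratum F A).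
Proof.
move=> ppF AF A0.
have ppc B : B \in cap_closure F -> pp_set B by exact: pp_cap_closure.
pose G := [fset B in cap_closure F | `[< (B `<` A)%classic /\ B !=set0 >]]%fset.
(* Keeping only the maximal members of [G] yields an antichain with the same union. *)
pose b := [fset B in G | `[< forall E, E \in G -> (B `<=` E)%classic -> E = B >]]%fset.
have bG B : B \in b ->
    [/\ B \in cap_closure F, B `<` A, B !=set0 & forall E, E \in G -> B `<=` E -> E = B].
  by rewrite !inE => /andP[/andP[BF /asboolP[BA B0]] /asboolP].
apply: (@represents_block A b); split=> /=.
- split=> [B /fset1P->|B E /fset1P-> /fset1P->] //; split=> //; exact: ppc.
- split=> [B /bG[BF _ B0 _]|B E Bb /bG[EF EA E0 _] BE].
    by split=> //; exact: ppc.
  have [_ _ _ hB] := bG B Bb; symmetry; apply: hB => //.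
  by rewrite !inE EF; exact/asboolP.
- by move=> B /bG[_ BA _ _]; exists A; rewrite // inE.
rewrite /stratum; apply/seteqP; split=> x [].
  move=> Ax nx; split; first by exists A => //=; rewrite inE.
  by move=> -[B /bG[BF BA _ _] Bx]; apply: nx; exists B.
move=> -[_ /= /fset1P-> Ax] nx; split=> // -[B [BF BA] Bx]; apply: nx.
have BG : B \in G by rewrite !inE BF /=; apply/asboolP; split=> //; exists x.
have [E [EG BE hE]] := exists_maximal BG.
exists E; last exact: BE.
by move: (EG); rewrite /= !inE => ->; exact/asboolP.
Qed.

Lemma constructible_block_partition D : constructible D ->
  exists s, block_partition s D.
Proof.
move=> [F [ppF hF]].
pose G := [fset A in cap_closure F |
  `[< A !=set0 /\ (stratum F A `<=` D)%classic >]]%fset.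
have hG A : A \in G ->
    [/\ A \in cap_closure F, A !=set0 & stratum F A `<=` D].
  by rewrite !inE => /andP[AF /asboolP[]].
exists [fset stratum F A | A in G]%fset; split.
  by move=> _ /imfsetP[A /= /hG[AF A0 _] ->]; exact: stratum_block.
split.
- apply/seteqP; split=> [x [_ /imfsetP[A /= /hG[_ _ AD] ->]]|x Dx]; first exact: AD.
  have [A [AF Ax AD]] := stratum_cover hF Dx.
  exists (stratum F A) => //=; apply/imfsetP; exists A => //=.
  by rewrite !inE AF; apply/asboolP; split=> //; exists x; case: Ax.
- move=> _ _ /imfsetP[A /= /hG[AF _ _] ->] /imfsetP[B /= /hG[BF _ _] ->] [x []].
  by move=> xA xB; rewrite (stratum_disjoint AF BF xA xB).
- by move=> _ /imfsetP[A /= /hG[AF A0 _] ->]; exact: stratum_nonempty.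
Qed.

(** Uniqueness of coefficients compares [L] with the combination of whichever partition [xget]
    picks; a partition exists, so the default [0] of [xget] is not taken. *)
Lemma kappa_coef L D P : constructible D -> ne_comb L -> indicates L D ->
  pp_set_ne P -> kappa P D = - coef L P.
Proof.
move=> /constructible_block_partition[s0 hs0] hL LD neP.
have [s hs ->] : exists2 s, block_partition s D &
    kappa P D = \sum_(B <- s) kappa_cell P B.
  apply: (@xgetPex _ _ [set k | exists2 s, block_partition s D
                              & k = \sum_(B <- s) kappa_cell P B]).
  by exists (\sum_(B <- s0) kappa_cell P B), s0.
rewrite (@coef_unique _ _ _ hM L (partition_comb s)) //.
- by rewrite (partition_comb_coef hs)// opprK.
- exact: partition_comb_ne hs.
- by move=> x; rewrite LD (partition_comb_val hs).
Qed.

(** Only the sets of [L] that lie in [X] can have a nonzero [kappa] among the members of [X], so the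
    sum over [X] reduces to one over the finite [S]. *)
Lemma Lambda_comb (X : set (set V)) L D : constructible D -> ne_comb L ->
  indicates L D -> X `<=` @pp_set_ne R M n ->
  Lambda X D = sumon L (fun A => `[< X A >]).
Proof.
move=> hD hL LD Xne; pose S := [fset p.2 | p in L & `[< X p.2 >]]%fset.
have memS p : p \in L -> X p.2 -> p.2 \in S.
  by move=> pL Xp; apply/imfsetP; exists p => //=; rewrite inE pL; exact/asboolP.
have SX P : P \in S -> X P.
  by move=> /imfsetP[p /=]; rewrite inE => /andP[_ /asboolP Xp] ->.
(* [sumon_coef] requires every set of the list to be in [S], so the terms outside [X] are removed
   first; coefficients on [X] are unaffected. *)
pose L' := [seq p <- L | `[< X p.2 >]].
have LE : sumon L (fun A => `[< X A >]) = sumon L' (fun A => `[< X A >]).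
  by rewrite /sumon /L' big_filter_cond; apply: eq_bigl => p; rewrite andbb.
rewrite LE (@sumon_coef _ _ _ L' _ S); last first.
  by move=> p; rewrite mem_filter => /andP[/asboolP Xp pL]; exact: memS.
have cE P : X P -> coef L' P = coef L P.
  move=> XP; rewrite /coef /sumon /L' big_filter_cond; apply: eq_bigl => p.
  by case: eqP => [->|_]; rewrite ?andbF// asboolT.
rewrite /Lambda (fsbigE (enum_fset S)); first last.
- move=> P XP PS; rewrite (kappa_coef hD hL LD (Xne _ XP)) coef_notin ?oppr0//.
  by move=> p pL; apply: contraNneq PS => e; rewrite -e; apply: memS; rewrite ?e.
- exact: SX.
- exact: fset_uniq.
rewrite -sumrN; apply: eq_big => [P|P].
  by apply/idP/asboolP; rewrite in_setE.
by rewrite inE => XP; rewrite cE// (kappa_coef hD hL LD (Xne _ XP)) opprK.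
Qed.

End Blocks.

(** * Images under injective affine maps *)

Section Pushforward.
Variables (R : pzRingType) (M : lmodType R^c) (m n : nat).
Implicit Types (A B G : set 'rV[M]_m) (h : 'rV[M]_m -> 'rV[M]_n).

Lemma pp_image h A : affine_map h -> pp_set A -> pp_set (h @` A).
Proof.
move=> hh ppA.
apply: (@pp_set_ext _ _ _ (lproj ([set z : 'rV[M]_(n + m) | A (rsubmx z)]
    `&` [set z | h (rsubmx z) = lsubmx z]))).
  move=> y; split=> [[x []]|[x Ax hx]].
    by rewrite /= row_mxKr row_mxKl => Ax hx; exists x.
  by exists x; split; rewrite /= row_mxKr ?row_mxKl.
have hr : affine_map (fun z : 'rV[M]_(n + m) => rsubmx z).
  exact: affine_map_rsub.
apply: pp_lproj; apply: pp_setI; first exact: pp_preimage hr ppA.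
by apply: pp_eq_map; [exact: affine_map_comp | exact: affine_map_lsub].
Qed.

(* If [z] and [z'] in [A] had the same image, then the fibre of a point [b] of
   [A] outside the [B] in [F] would contain [b + z' - z]; by irreducibility
   the fibre lies in [[set b]] or in a member of [F]. *)
Lemma inj_on_generic h A (F : {fset set 'rV[M]_m}) : theory_stable M ->
  affine_map h -> (forall x y z, h (x - y + z) = h x - h y + h z) ->
  pp_set_ne A -> (forall B, B \in F -> pp_set B /\ ~ A `<=` B) ->
  set_inj (A `\` \bigcup_(B in [set` F]) B) h -> set_inj A h.
Proof.
move=> hM hh hadd [ppA A0] hF hinj z' z; rewrite !in_setE => Az' Az hz.
have [b [Ab nb]] : exists b, (A `\` \bigcup_(B in [set` F]) B) b.
  apply: contrapT => ne.
  have [B BF|x Ax|B BF AB] := pp_irreducible hM ppA A0 (F := F).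
  - by have [] := hF B BF.
  - by apply: contrapT => nx; apply: ne; exists x.
  - by have [_] := hF B BF.
pose fib := A `&` [set x | h x = h b].
have ppfib : pp_set fib.
  by apply: pp_setI => //; apply: pp_eq_map => //; exact: affine_map_cst.
have pp1 : pp_set [set b].
  by apply: pp_eq_map; [exact: affine_map_id | exact: affine_map_cst].
have fibz : fib (z' - z + b).
  split; first exact: pp_set_maltsev.
  by rewrite /= hadd hz subrr add0r.
have [|B|x [Ax hx]|B] := pp_irreducible hM ppfib _ (F := ([set b] |` F)%fset).
- by exists b.
- by rewrite !inE => /orP[/eqP->//|/hF[]].
- have [[B BF Bx]|nx] := pselect ((\bigcup_(B in [set` F]) B) x).
    by exists B => //=; rewrite !inE (BF : B \in F) orbT.
  exists [set b]; first by rewrite /= !inE eqxx.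
  by apply: hinj; rewrite ?in_setE.
rewrite !inE => /orP[/eqP->|BF] fB.
  by have /= := fB _ fibz => /(canRL (addrK b)); rewrite subrr => /subr0_eq.
by case: nb; exists B => //; apply: fB; split.
Qed.

Definition push_comb h (L : seq (int * set 'rV[M]_m)) : seq (int * set 'rV[M]_n) :=
  [seq (p.1, h @` p.2) | p <- L].

Lemma sumon_push h L Q : sumon (push_comb h L) Q = sumon L (fun A => Q (h @` A)).
Proof. by rewrite /sumon big_map. Qed.

Lemma push_comb_ne h L : affine_map h -> ne_comb L -> ne_comb (push_comb h L).
Proof.
move=> hh hL _ /mapP[p /hL[ppA [x Ax]] ->]; split; first exact: pp_image.
by exists (h x); exists x.
Qed.

(* Both sides are summed over a finite subset [Z] of the fibre of [h] over the
   given point that meets [G] and each set of [L] whenever the fibre does. *)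
Lemma push_comb_indicates h L G : indicates L G -> set_inj G h ->
  (forall p, p \in L -> set_inj p.2 h) -> indicates (push_comb h L) (h @` G).
Proof.
move=> LG injG injL x.
pose pt A : 'rV[M]_m := xget 0 [set z | A z /\ h z = x].
pose Z := [fset pt A | A in G :: [seq p.2 | p <- L] & `[< (h @` A)%classic x >]]%fset.
have ptP A : (h @` A) x -> A (pt A) /\ h (pt A) = x.
  move=> [z Az hz]; exact: (@xgetI _ 0 [set z | A z /\ h z = x] z).
have Zx z : z \in Z -> h z = x.
  by move=> /imfsetP[A /=]; rewrite inE => /andP[_ /asboolP/ptP[_ hA]] ->.
have countZ A : A \in G :: [seq p.2 | p <- L] -> set_inj A h ->
    \sum_(z <- Z) (`[< A z >] : nat)%:Z = (`[< (h @` A) x >] : nat)%:Z.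
  move=> AS injA; have [hAx|nhAx] := pselect ((h @` A) x); last first.
    rewrite (asboolF nhAx) big1_seq// => z /andP[_ /Zx hz].
    by rewrite asboolF// => Az; apply: nhAx; exists z.
  have [Apt hpt] := ptP A hAx.
  have ptZ : pt A \in Z.
    by apply/imfsetP; exists A => //; rewrite inE AS; exact/asboolP.
  rewrite (asboolT hAx) (bigD1_seq (pt A)) ?fset_uniq//= (asboolT Apt).
  rewrite big1_seq ?addr0// => z /andP[zpt zZ].
  rewrite asboolF// => Az; case/eqP: zpt; apply: injA; rewrite ?in_setE//.
  by rewrite hpt; exact: Zx.
rewrite -countZ ?mem_head//.
under eq_bigr do rewrite -LG /comb_val /sumon big_mkcond.
rewrite exchange_big /= /comb_val sumon_push /sumon big_mkcond.
apply: eq_big_seq => p pL.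
have := countZ p.2; rewrite inE map_f// orbT => /(_ isT (injL p pL)) cp.
transitivity (p.1 * (`[< (h @` p.2) x >] : nat)%:Z).
  by case: asboolP; rewrite ?mulr1 ?mulr0.
rewrite -cp mulr_sumr; apply: eq_bigr => z _.
by case: asboolP; rewrite ?mulr1 ?mulr0.
Qed.

(** Sending [h' z] to [h z] for [z] in [B] is a pp-bijection between the two images; composing it
    with [f] gives the required bijection onto [P]. *)
Lemma colour_image (h h' : 'rV[M]_m -> 'rV[M]_n) B P :
  affine_map h -> affine_map h' -> pp_set B -> set_inj B h -> set_inj B h' ->
  colour P (h @` B) -> colour P (h' @` B).
Proof.
move=> hh hh' ppB injh injh' [_ [f [fP injf surjf] ppf]].
split; first exact: pp_image.
pose pt y : 'rV[M]_m := xget 0 [set z | B z /\ h' z = y].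
have ptK z : B z -> pt (h' z) = z.
  move=> Bz.
  have [Bpt hpt] := @xgetI _ 0 [set z0 | B z0 /\ h' z0 = h' z] z (conj Bz erefl).
  by apply: injh'; rewrite ?in_setE.
exists (fun y => f (h (pt y))).
  split.
  - by move=> _ [z Bz <-]; rewrite /= ptK//; apply: fP; exists z.
  - move=> y1 y2; rewrite !in_setE => -[z1 B1 <-] [z2 B2 <-]; rewrite !ptK// => e.
    have := injf (h z1) (h z2); rewrite !in_setE.
    move=> /(_ (ex_intro2 _ _ z1 B1 erefl) (ex_intro2 _ _ z2 B2 erefl) e) e'.
    by rewrite (injh z1 z2) ?in_setE.
  move=> p Pp; have [_ [z Bz <-] fz] := surjf p Pp.
  by exists (h' z); [exists z | rewrite ptK].
(* The three blocks of [v] are the argument, the value and the point of [B] lying over the argument;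
   projecting the last one away gives the graph. *)
pose W := [set v : 'rV[M]_(n + n + m) | B (rsubmx v)]
  `&` [set v | h' (rsubmx v) = lsubmx (lsubmx v)]
  `&` [set v | graph_on (h @` B) f (row_mx (h (rsubmx v)) (rsubmx (lsubmx v)))].
have hr : affine_map (fun v : 'rV[M]_(n + n + m) => rsubmx v).
  exact: affine_map_rsub.
have hl : affine_map (fun v : 'rV[M]_(n + n + m) => lsubmx v).
  exact: affine_map_lsub.
apply: (@pp_set_ext _ _ _ (lproj W)) => [w|].
  split=> [[z [[]]]|[_ [z Bz <-] ->]]; last first.
    exists z; split; first split; rewrite /= ?row_mxKr ?row_mxKl//.
    by exists (h z); [exists z | rewrite row_mxKr ptK].
  rewrite /= !row_mxKr !row_mxKl => Bz hz [_ [z' Bz' <-] /eq_row_mx[e1 e2]].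
  exists (lsubmx w); first by exists z.
  by rewrite -hz ptK// e1 -e2 hz hsubmxK.
apply: pp_lproj; apply: pp_setI; first apply: pp_setI.
- exact: pp_preimage hr ppB.
- apply: pp_eq_map; first exact: affine_map_comp.
  by apply: affine_map_comp hl; exact: affine_map_lsub.
apply: (@pp_preimage _ _ _ _ _
  (fun v => row_mx (h (rsubmx v)) (rsubmx (lsubmx v)))) => //.
apply: affine_map_row; first exact: affine_map_comp.
by apply: affine_map_comp hl; exact: affine_map_rsub.
Qed.

End Pushforward.

(** * Invariance under definable bijections *)

Theorem theorem3p5p9 (R : pzRingType) (M : lmodType R^c)
  (hM : theory_stable M) (n : nat) (hn : (0 < n)%N)
  (D D' : set 'rV[M]_n) (hD : definable D) (hD' : definable D')
  (f : 'rV[M]_n -> 'rV[M]_n) (hf : set_bij D D' f)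
  (hfdef : definable (graph_on D f))
  (X : set (set 'rV[M]_n)) (hX : colours X) :
  Lambda X D = Lambda X D'.
Proof.
have [fD injf surjf] := hf; set G := graph_on D f in hfdef.
have injl : set_inj G lsubmx.
  move=> z z'; rewrite !in_setE => -[x _ ->] [x' _ ->].
  by rewrite !row_mxKl => ->.
have injr : set_inj G rsubmx.
  move=> z z'; rewrite !in_setE => -[x Dx ->] [x' Dx' ->].
  by rewrite !row_mxKr => e; rewrite (injf x x') ?in_setE.
have lG : lsubmx @` G = D.
  apply/seteqP; split=> [_ [_ [x Dx ->] <-]|x Dx]; first by rewrite row_mxKl.
  by exists (row_mx x (f x)); [exists x | rewrite row_mxKl].
have rG : rsubmx @` G = D'.
  apply/seteqP; split=> [_ [_ [x Dx ->] <-]|y /surjf[x Dx <-]].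
    by rewrite row_mxKr; exact: fD.
  by exists (row_mx x (f x)); [exists x | rewrite row_mxKr].
have [s hs] := constructible_block_partition hM (definable_constructible hM hfdef).
pose L := partition_comb s.
have neL : ne_comb L := partition_comb_ne hs.
have affl : affine_map (@lsubmx M 1 n n) by exact: affine_map_lsub.
have affr : affine_map (@rsubmx M 1 n n) by exact: affine_map_rsub.
(* [p.2] lies in a pp-set [A] that, up to the members of [F], is contained in [G]; injectivity on
   [G] thus passes to [A] and to [p.2]. *)
have inj_comb (h : 'rV[M]_(n + n) -> 'rV[M]_n) p : affine_map h ->
    (forall x y z, h (x - y + z) = h x - h y + h z) -> set_inj G h ->
    p \in L -> set_inj p.2 h.
  move=> hh hadd hinj /(partition_comb_sub hs)[A [F [neA pA hF AG]]].
  apply: (sub_in2 _ (inj_on_generic hM hh hadd neA hF _)).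
    by move=> x; rewrite !in_setE; exact: pA.
  by apply: sub_in2 hinj => x; rewrite !in_setE; exact: AG.
have inj_l p : p \in L -> set_inj p.2 lsubmx.
  by apply: inj_comb => // x y z; apply/rowP => j; rewrite !mxE.
have inj_r p : p \in L -> set_inj p.2 rsubmx.
  by apply: inj_comb => // x y z; apply/rowP => j; rewrite !mxE.
(* The definition of [colour] does not demand nonemptiness; it follows from the bijection with a
   nonempty [P]. *)
have neX : X `<=` @pp_set_ne R M n.
  move: hX => [P [_ [x0 Px0]] ->] A [ppA [g [_ _ surjg] _]]; split=> //.
  by have [x Ax _] := surjg x0 Px0; exists x.
have LG : indicates L G := partition_comb_val hs.
rewrite (@Lambda_comb _ _ _ hM X (push_comb lsubmx L)) //; first last.
- by rewrite -lG; exact: push_comb_indicates.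
- exact: push_comb_ne.
- exact: definable_constructible.
rewrite (@Lambda_comb _ _ _ hM X (push_comb rsubmx L)) //; first last.
- by rewrite -rG; exact: push_comb_indicates.
- exact: push_comb_ne.
- exact: definable_constructible.
(* The comparison is termwise: both images of [p.2] are in bijection with it by projections, so one
   belongs to the colour exactly when the other does. *)
rewrite !sumon_push; apply: eq_sumon => p pL; have [ppp _] := neL p pL.
move: hX => [P _ ->].
by apply/asboolP/asboolP; apply: colour_image; rewrite //; auto.
Qed.
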